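(* Let $v$ be an odd positive integer with $v>1$. Then there exists a Paley type partial difference set in some abelian group $G$ of order $v$ if and only if at least one of the following holds: (i) $v$ is a prime power and $v \equiv 1 \pmod 4$; or (ii) $v=n^4$ or $v=9n^4$ for some odd positive integer $n>1$.
   Context: Let $G$ be a finite abelian group of order $v$, written multiplicatively with identity element $e$, and let $D\subseteq G$ be a subset of size $k$. $D$ is called a $(v,k,\lambda,\mu)$-partial difference set (PDS) in $G$ if the expressions $gh^{-1}$ with $g,h\in D$, $g\neq h$, represent each non-identity element of $D$ exactly $\lambda$ times, and each non-identity element of $G$ not in $D$ exactly $\mu$ times. A PDS $D$ is called regular if in addition $D^{(-1)}=D$, where $D^{(-1)}=\{g^{-1}: g\in D\}$, and $e\notin D$. If $v\equiv 1 \pmod 4$, a regular $\left(v,\frac{v-1}{2},\frac{v-5}{4},\frac{v-1}{4}\right)$-PDS in $G$ is called a Paley type partial difference set; in particular, a Paley type partial difference set in a group of order $v$ is only defined when $v\equiv 1\pmod 4$. *)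

(* Defs.v *)
From mathcomp Require Import all_boot all_fingroup.

Set Implicit Arguments.
Unset Strict Implicit.
Unset Printing Implicit Defensive.

(* Counts ordered pairs (g, h). *)
Definition diff_count (gT : finGroupType) (D : {set gT}) (x : gT) : nat :=
  #|[set p in setX D D | (p.1 != p.2) && ((p.1 * p.2^-1)%g == x)]|.

Definition is_PDS (gT : finGroupType) (G : {group gT}) (D : {set gT})
    (v k lambda mu : nat) : Prop :=
  [/\ #|G| = v,
      D \subset G,
      #|D| = k,
      forall x, x \in D -> x != 1%g -> diff_count D x = lambda
    & forall x, x \in G -> x \notin D -> x != 1%g -> diff_count D x = mu].

(* The inverse of the set D is taken elementwise: [set g^-1 | g in D]. *)
Definition is_regular_PDS (gT : finGroupType) (G : {group gT}) (D : {set gT})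
    (v k lambda mu : nat) : Prop :=
  [/\ is_PDS G D v k lambda mu, (D^-1)%g = D & 1%g \notin D].

(* The divisions are exact when #|G| = 1 %[mod 4]. The subtraction #|G| - 5
   only truncates when #|G| = 1; then D is empty and lambda is irrelevant. *)
Definition is_Paley_PDS (gT : finGroupType) (G : {group gT}) (D : {set gT}) :
    Prop :=
  #|G| = 1 %[mod 4] /\
  is_regular_PDS G D #|G| ((#|G| - 1) %/ 2) ((#|G| - 5) %/ 4)
    ((#|G| - 1) %/ 4).

Definition is_prime_power (v : nat) : Prop :=
  exists p m : nat, [/\ prime p, 0 < m & v = p ^ m].

(* Main.v *)
Require Import Defs.
From HB Require Import structures.
From mathcomp Require Import all_boot all_order all_fingroup all_algebra
  all_solvable all_field all_character.
From mathcomp Require Import ring zify.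

Set Implicit Arguments.
Unset Strict Implicit.
Unset Printing Implicit Defensive.

Import Order.TTheory GRing.Theory Num.Theory.
Local Open Scope ring_scope.

(** Encode a symmetric subset [D] of [G] that avoids [1] by the function [f] that
    is [1] on [D], [0] at [1] and [-1] elsewhere: [D] is of Paley type iff
    [f * f = v delta - 1] for the convolution product.

    Sufficiency.  Prime powers are handled by the quadratic character.  For the
    other orders, call a Turyn family four even functions [b_i] with values
    [1, -1], equal to [1] at [0] and of product [-1] elsewhere, such that
    [b_i * b_j = 1] for [i != j] and [sum_i b_i * b_i = 4 v delta].  Then
    [(b_0 + b_1 - b_2 - b_3) / 2] encodes a Paley type set, and Turyn's
    composition makes the product of two Turyn families a Turyn family.  In
    [(F_3)^2] take [2 L - 1] for the four lines [L].  In [K^2] with [|K| = p^2],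
    take signed sums of lines and of half-lines (the lines weighted by the
    quadratic character of [K]); the signs come from two vectors with entries
    [1, -1] that are eigenvectors of the Paley conference matrix of order [p^2 + 1]
    for the eigenvalues [p] and [-p].  Such vectors are constant on the cosets of
    [F_p], respectively of [beta F_p] with [beta] a nonsquare.

    Necessity.  Let [p] divide [v], not a prime power, and write [G = P x Q] with
    [P] the Sylow [p]-subgroup.  The sums [F] of [f] over the cosets of [P] satisfy
    [F * F = |P| (|Q| delta - 1)] on [Q]; reducing modulo [p] and using Frobenius,
    [F] is divisible by [p] as often as possible, so [|P| = p^(2s)], [F = p^s h]
    and [h * h = |Q| delta - 1].  As [h] is odd outside [1], [F = p^s] or
    [F = -p^s] there.  Hence [v] is a square, and Frobenius modulo the primes not
    dividing [v] shows that [f] is invariant under [x -> x^t] for [t] prime to [v].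
    Collecting the terms of [F y] along these orbits gives [F y = f y] modulo
    [2 (p - 1)], which for odd [s] leaves only [p = 3]. *)

(** * Convolution and Turyn families *)

(** Joins the finite and the additive structure of a product, so that [V * W] is a [finZmodType]. *)
HB.instance Definition _ (V W : finZmodType) := GRing.Zmodule.on (V * W)%type.

Definition conv (V : finZmodType) (f g : V -> int) (z : V) : int :=
  \sum_x f x * g (z - x).

Section Convolution.
Variable V : finZmodType.
Implicit Types (f g h : V -> int) (z : V).

Lemma eq_conv f f' g g' : f =1 f' -> g =1 g' -> conv f g =1 conv f' g'.
Proof. by move=> ff' gg' z; apply: eq_bigr => x _; rewrite ff' gg'. Qed.

Lemma convC f g : conv f g =1 conv g f.
Proof.
move=> z; rewrite /conv (reindex_inj (inv_inj (subKr z))).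
by apply: eq_bigr => x _; rewrite subKr mulrC.
Qed.

Lemma convDl f f' g z : conv (f \+ f') g z = conv f g z + conv f' g z.
Proof. by rewrite -big_split; apply: eq_bigr => x _; rewrite /= mulrDl. Qed.

Lemma convBl f f' g z : conv (f \- f') g z = conv f g z - conv f' g z.
Proof.
by rewrite /conv -sumrB; apply: eq_bigr => x _; rewrite /= mulrBl.
Qed.

Lemma convDr f g g' z : conv f (g \+ g') z = conv f g z + conv f g' z.
Proof. by rewrite -!(convC _ f) convDl. Qed.

Lemma convBr f g g' z : conv f (g \- g') z = conv f g z - conv f g' z.
Proof. by rewrite -!(convC _ f) convBl. Qed.

Lemma convZl (a : int) f g z : conv (fun x => a * f x) g z = a * conv f g z.
Proof. by rewrite mulr_sumr; apply: eq_bigr => x _; rewrite mulrA. Qed.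

Lemma conv_suml (I : finType) (P : pred I) (F : I -> V -> int) g z :
  conv (fun x => \sum_(i | P i) F i x) g z = \sum_(i | P i) conv (F i) g z.
Proof.
rewrite /conv exchange_big; apply: eq_bigr => x _ /=.
by rewrite mulr_suml.
Qed.

Lemma conv_sumr (I : finType) (P : pred I) (F : I -> V -> int) g z :
  conv g (fun x => \sum_(i | P i) F i x) z = \sum_(i | P i) conv g (F i) z.
Proof.
by rewrite convC conv_suml; apply: eq_bigr => i _; rewrite convC.
Qed.

End Convolution.

Definition tens (V W : finZmodType) (f : V -> int) (g : W -> int)
  (x : V * W) : int := f x.1 * g x.2.

Lemma conv_tens (V W : finZmodType) (f f' : V -> int) (g g' : W -> int) z :
  conv (tens f g) (tens f' g') z = conv f f' z.1 * conv g g' z.2.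
Proof.
rewrite /conv mulr_suml.
under [RHS]eq_bigr do rewrite mulr_sumr.
by rewrite pair_big; apply: eq_bigr => -[x y] _; rewrite /tens /=; ring.
Qed.

Record turyn_family (V : finZmodType) (b0 b1 b2 b3 : V -> int) : Prop := {
  tf_even : forall x,
    [/\ b0 (- x) = b0 x, b1 (- x) = b1 x, b2 (- x) = b2 x & b3 (- x) = b3 x];
  tf_sign : forall x,
    [/\ b0 x ^+ 2 = 1, b1 x ^+ 2 = 1, b2 x ^+ 2 = 1 & b3 x ^+ 2 = 1];
  tf_0 : [/\ b0 0 = 1, b1 0 = 1, b2 0 = 1 & b3 0 = 1];
  tf_prod : forall x, x != 0 -> b0 x * b1 x * b2 x * b3 x = -1;
  tf_conv01 : forall z, conv b0 b1 z = 1;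
  tf_conv02 : forall z, conv b0 b2 z = 1;
  tf_conv03 : forall z, conv b0 b3 z = 1;
  tf_conv12 : forall z, conv b1 b2 z = 1;
  tf_conv13 : forall z, conv b1 b3 z = 1;
  tf_conv23 : forall z, conv b2 b3 z = 1;
  tf_sum : forall z, conv b0 b0 z + conv b1 b1 z + conv b2 b2 z + conv b3 b3 z
    = 4 * #|V|%:Z * (z == 0)%:R }.

Definition has_turyn_family (n : nat) : Prop :=
  exists (V : finZmodType) (b0 b1 b2 b3 : V -> int),
    #|V| = n /\ turyn_family b0 b1 b2 b3.

Lemma sqr1_int (a : int) : a ^+ 2 = 1 -> a = 1 \/ a = -1.
Proof. by move/eqP; rewrite sqrf_eq1 => /orP[] /eqP; [left | right]. Qed.

(** For functions with values 1 and -1, [hsum] is [(f + g) / 2] and [hdiff] is [(f - g) / 2],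
    written without division; their supports are complementary. *)
Definition hsum (T : Type) (f g : T -> int) (x : T) : int :=
  if f x == g x then f x else 0.
Definition hdiff (T : Type) (f g : T -> int) (x : T) : int :=
  if f x == g x then 0 else f x.

Section HalfSums.
Variables (T : Type) (f g : T -> int).
Hypotheses (f2 : forall x, f x ^+ 2 = 1) (g2 : forall x, g x ^+ 2 = 1).

Lemma hsumDhdiff : f =1 hsum f g \+ hdiff f g.
Proof.
by move=> x; rewrite /hsum /hdiff /=; case: eqP => _; rewrite ?addr0 ?add0r.
Qed.

Lemma hsumBhdiff : g =1 hsum f g \- hdiff f g.
Proof.
move=> x; rewrite /hsum /hdiff /=.
by case: (sqr1_int (f2 x)) (sqr1_int (g2 x)) => -> [] ->.
Qed.

End HalfSums.

(** The halves [p], [q] of [c0], [c1] and [p'], [q'] of [c2], [c3] serve as coefficients for the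
    [b_i]. Their supports being complementary, each combination is again a sign. *)
Lemma turyn_family_prod m n :
  has_turyn_family m -> has_turyn_family n -> has_turyn_family (m * n).
Proof.
move=> [V [b0 [b1 [b2 [b3 [<- HV]]]]]] [W [c0 [c1 [c2 [c3 [<- HW]]]]]].
have cs x := tf_sign HW x.
have s0 x : c0 x ^+ 2 = 1 by case: (cs x).
have s1 x : c1 x ^+ 2 = 1 by case: (cs x).
have s2 x : c2 x ^+ 2 = 1 by case: (cs x).
have s3 x : c3 x ^+ 2 = 1 by case: (cs x).
set p := hsum c0 c1; set q := hdiff c0 c1.
set p' := hsum c2 c3; set q' := hdiff c2 c3.
have e0 : c0 =1 p \+ q := hsumDhdiff _ _.
have e1 : c1 =1 p \- q := hsumBhdiff s0 s1.
have e2 : c2 =1 p' \+ q' := hsumDhdiff _ _.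
have e3 : c3 =1 p' \- q' := hsumBhdiff s2 s3.
exists (V * W)%type, (tens b0 p \+ tens b1 q), (tens b2 p \- tens b3 q),
  (tens b0 q' \+ tens b1 p'), (tens b3 p' \- tens b2 q').
split; first by rewrite card_prod.
(* The Turyn conditions on the [c_i], solved for the halves: for instance
   [c0 * c1 = p * p - q * q]. *)
have convE z : let P := conv p p z in let Q := conv q q z in
    let P' := conv p' p' z in let Q' := conv q' q' z in
    [/\ P - Q = 1, P' - Q' = 1,
        P + Q + P' + Q' = 2 * #|W|%:Z * (z == 0)%:R &
        [/\ conv p p' z = 1, conv p q' z = 0, conv q p' z = 0
          & conv q q' z = 0]].
  have h01 := tf_conv01 HW z; have h02 := tf_conv02 HW z.
  have h03 := tf_conv03 HW z; have h12 := tf_conv12 HW z.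
  have h13 := tf_conv13 HW z; have h23 := tf_conv23 HW z.
  have hs := tf_sum HW z.
  rewrite (eq_conv e0 e1) in h01; rewrite (eq_conv e0 e2) in h02.
  rewrite (eq_conv e0 e3) in h03; rewrite (eq_conv e1 e2) in h12.
  rewrite (eq_conv e1 e3) in h13; rewrite (eq_conv e2 e3) in h23.
  rewrite (eq_conv e0 e0) (eq_conv e1 e1) (eq_conv e2 e2) (eq_conv e3 e3) in hs.
  move: h01 h02 h03 h12 h13 h23 hs.
  rewrite !(convBl, convBr, convDl, convDr) (convC q p) (convC q' p').
  move: (z == 0) => e *; split; last split; lia.
have p0 : [/\ p 0 = 1, q 0 = 0, p' 0 = 1 & q' 0 = 0].
  by rewrite /p /q /p' /q' /hsum /hdiff; case: (tf_0 HW) => -> -> -> ->.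
have [vb0 vb1 vb2 vb3] := tf_0 HV; have [vp vq vp' vq'] := p0.
(* For [y != 0] the product -1 lets exactly one of the pairs [c0, c1] and [c2, c3] agree at [y], so
   the nonzero halves are [p, q'] or [q, p']. At [y = 0] they are [p] and [p'], and the product is
   that of the [b_i]. *)
have vals x y : (x, y) != 0 :> V * W ->
  let B0 := b0 x * p y + b1 x * q y in let B1 := b2 x * p y - b3 x * q y in
  let B2 := b0 x * q' y + b1 x * p' y in let B3 := b3 x * p' y - b2 x * q' y in
  [/\ B0 ^+ 2 = 1, B1 ^+ 2 = 1, B2 ^+ 2 = 1 & B3 ^+ 2 = 1]
  /\ B0 * B1 * B2 * B3 = -1.
  have [b02 b12 b22 b32] := tf_sign HV x.
  rewrite xpair_eqE negb_and /=; have [->|y0 _] := eqVneq y 0.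
    rewrite orbF vp vq vp' vq' => /(tf_prod HV) hx.
    rewrite !(mulr1, mulr0, subr0, addr0, add0r); split=> //.
    by rewrite -hx; ring.
  have hy := tf_prod HW y0; have [x0|x0] := eqVneq x 0.
    rewrite x0 vb0 vb1 vb2 vb3 !mul1r.
    rewrite -[p y + q y]/((p \+ q) y) -[p y - q y]/((p \- q) y) -e0 -e1.
    rewrite [q' y + _]addrC -[p' y + _]/((p' \+ q') y).
    by rewrite -[p' y - q' y]/((p' \- q') y) -e2 -e3.
  move: (tf_prod HV x0) b02 b12 b22 b32 hy (s0 y) (s1 y) (s2 y) (s3 y).
  rewrite /p /q /p' /q' /hsum /hdiff.
  move=> hx /sqr1_int hb0 /sqr1_int hb1 /sqr1_int hb2 /sqr1_int hb3.
  move=> hy /sqr1_int hc0 /sqr1_int hc1 /sqr1_int hc2 /sqr1_int hc3; move: hx hy.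
  case: hb0 => ->; case: hb1 => ->; case: hb2 => ->; case: hb3 => -> //;
  case: hc0 => ->; case: hc1 => ->; case: hc2 => ->; case: hc3 => -> //.
split=> [[x y]|[x y]||x|[x y]|[x y]|[x y]|[x y]|[x y]|[x y]|[x y]] /=.
- rewrite /tens /= /p /q /p' /q' /hsum /hdiff.
  by have [-> -> -> ->] := tf_even HV x; have [-> -> -> ->] := tf_even HW y.
- rewrite /tens /=; have [[-> ->]|/vals[]//] := eqVneq (x, y) (0 : V * W).
  by rewrite vb0 vb1 vb2 vb3 vp vq vp' vq'.
- by rewrite /tens /= vb0 vb1 vb2 vb3 vp vq vp' vq'.
- by case: x => x y /vals[] _; rewrite /tens.
all: rewrite ?(convBl, convBr, convDl, convDr) !conv_tens /=.
all: have [hP hP' hS [h1 h2 h3 h4]] := convE y.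
all: rewrite ?(convC b1 b0) ?(convC b2 b0) ?(convC b3 b0) ?(convC b2 b1)
  ?(convC b3 b1) ?(convC b3 b2) ?(convC q p) ?(convC q' p') ?(convC p' p)
  ?(convC q' p) ?(convC p' q) ?(convC q' q).
all: rewrite ?(tf_conv01 HV) ?(tf_conv02 HV) ?(tf_conv03 HV) ?(tf_conv12 HV)
  ?(tf_conv13 HV) ?(tf_conv23 HV) ?h1 ?h2 ?h3 ?h4.
all: try lia.
have hV := tf_sum HV x.
(* The squares [b0 * b0] and [b2 * b2] have coefficient [p * p + q' * q'], the other two
   [q * q + p' * p']. Both agree because [p * p - q * q] and [p' * p' - q' * q'] equal 1. *)
have e : conv q q y + conv p' p' y = conv p p y + conv q' q' y by lia.
have e2' : conv p p y + conv q' q' y = #|W|%:Z * (y == 0)%:R.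
  by move: (y == 0) hS => d; lia.
transitivity ((conv b0 b0 x + conv b1 b1 x + conv b2 b2 x + conv b3 b3 x)
  * (conv p p y + conv q' q' y)).
  rewrite !mulrDl -{2}e -{3}e; ring.
rewrite hV e2' card_prod PoszM -[(x, y) == 0]/((x == 0) && (y == 0)).
by case: (x == 0); case: (y == 0); rewrite /=; ring.
Qed.

(** * Paley type partial difference sets as functions *)

Section PaleySign.
Variables (gT : finGroupType) (G : {group gT}).
Implicit Types (D : {set gT}) (x z : gT) (f g : gT -> int).

Definition psign (D : {set gT}) (x : gT) : int :=
  2 * (x \in D)%:R - 1 + (x == 1%g)%:R.

Definition gconv (f g : gT -> int) (z : gT) : int :=
  \sum_(x in G) f x * g (x^-1 * z)%g.

Lemma sum_gconv f g :
  \sum_(z in G) gconv f g z = (\sum_(x in G) f x) * (\sum_(x in G) g x).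
Proof.
rewrite exchange_big mulr_suml; apply: eq_bigr => x Gx /=.
rewrite -mulr_sumr; congr (_ * _).
rewrite (reindex_inj (mulgI x)); apply: eq_big => [y|y _]; first by rewrite groupMl.
by rewrite mulKg.
Qed.

Lemma psign_val D x : (1%g \notin D) ->
  psign D x = if x == 1%g then 0 else if x \in D then 1 else -1.
Proof.
by rewrite /psign; case: eqP => [->|_] D1; [rewrite (negPf D1) | case: (x \in D)].
Qed.

Lemma sum_delta (F : gT -> int) z : z \in G ->
  \sum_(x in G) (x == z)%:R * F x = F z.
Proof.
move=> Gz; rewrite (bigD1 z) //= eqxx mul1r big1 ?addr0 // => x /andP[_ /negPf->].
by rewrite mul0r.
Qed.

(** Summed over [z], the hypothesis says that the square of the sum of [f] is [#|G| - #|G|]. *)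
Lemma gconv_sum_eq0 f :
  (forall z, z \in G -> gconv f f z = #|G|%:Z * (z == 1%g)%:R - 1) ->
  \sum_(x in G) f x = 0.
Proof.
move=> cf; apply/eqP; rewrite -sqrf_eq0 expr2 -sum_gconv (eq_bigr _ cf).
rewrite sumrB sumr_const -mulr_sumr -(eq_bigr _ (fun x _ => mulr1 _)).
by rewrite sum_delta ?group1 // mulr1 (natz #|G|) subrr.
Qed.

Lemma sum_mem (D : {set gT}) : D \subset G ->
  \sum_(x in G) (x \in D)%:R = #|D|%:Z.
Proof.
move=> sDG; rewrite -natz -sum1_card natr_sum.
rewrite [RHS]big_mkcond [LHS]big_mkcond; apply: eq_bigr => x _.
by case: (boolP (x \in D)) => [/(subsetP sDG)->|]; rewrite ?if_same.
Qed.

Lemma sum_psign D : D \subset G ->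
  \sum_(x in G) psign D x = 2 * #|D|%:Z - #|G|%:Z + 1.
Proof.
move=> sDG; rewrite /psign !big_split /= -mulr_sumr sum_mem // sumrN sumr_const.
have /= := sum_delta (fun=> 1) (group1 G); under eq_bigr do rewrite mulr1.
by move=> ->; rewrite (natz #|G|).
Qed.

(** A pair with quotient [z] is determined by its first entry [x]; the second, [z^-1 * x], lies in
    [D] iff its inverse does. *)
Lemma diff_countE D z : D \subset G -> (D^-1)%g = D -> z \in G -> z != 1%g ->
  (diff_count D z)%:Z = \sum_(x in G) (x \in D)%:R * (x^-1 * z \in D)%g%:R.
Proof.
move=> sDG DV Gz z1.
have -> : diff_count D z = #|[set x in D | x^-1 * z \in D]%g|.
  rewrite /diff_count -(card_imset _ (f := fun x => (x, z^-1 * x)%g));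
    last by move=> x y [].
  apply: eq_card => -[g h]; rewrite !inE /=; apply/idP/imsetP.
    case/and3P=> /andP[Dg Dh] _ /eqP <-; exists g.
      by rewrite inE Dg mulgA mulVg mul1g -DV inE invgK.
    by rewrite invMg invgK mulgKV.
  case=> x; rewrite inE => /andP[Dx Dxz] [-> ->]; rewrite Dx.
  have -> : (z^-1 * x)%g \in D by rewrite -DV mem_invg invMg invgK.
  rewrite /= invMg invgK mulKVg eqxx andbT.
  by rewrite -{1}(mul1g x) (inj_eq (mulIg x)) eq_sym invg_eq1.
rewrite -sum_mem; last by apply/subsetP=> x; rewrite inE => /andP[/(subsetP sDG)].
by apply: eq_bigr => x _; rewrite inE; do 2!case: (_ \in D).
Qed.

Lemma gconv_psign D z : D \subset G -> (D^-1)%g = D -> (1%g \notin D) ->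
  z \in G -> z != 1%g ->
  gconv (psign D) (psign D) z
    = 4 * (diff_count D z)%:Z - 4 * #|D|%:Z + #|G|%:Z + 2 * psign D z.
Proof.
move=> sDG DV D1 Gz z1; rewrite diff_countE //.
have sV (F : gT -> int) : \sum_(x in G) F (x^-1 * z)%g = \sum_(x in G) F x.
  rewrite [RHS](reindex_inj (inj_comp (mulIg z) invg_inj)) /=.
  by apply: eq_bigl => x; rewrite groupMr ?groupV.
transitivity (\sum_(x in G) (4 * ((x \in D)%:R * (x^-1 * z \in D)%g%:R) - 2 *
  (x \in D)%:R
   - 2 * (x^-1 * z \in D)%g%:R + 1 + (x == z)%:R * (2 * (x \in D)%:R - 1)
   + (x == 1)%g%:R * psign D (x^-1 * z)%g) : int).
  apply: eq_bigr => x _; rewrite /psign.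
  have -> : (x^-1 * z == 1)%g = (x == z) by rewrite -eq_mulVg1.
  by ring.
rewrite !(big_split, sumrN) /= !sum_delta // invg1 mul1g -!mulr_sumr.
rewrite (sV (fun y => (y \in D)%:R)) sumr_const sum_mem // /psign (negPf z1).
by rewrite (natz #|G|); move: (bigop.body _ _ _) => S; rewrite mulr0n; ring.
Qed.

(** Off 1 this is [gconv_psign] with the values of lambda and mu. Conversely the size of [D] comes
    from [gconv_sum_eq0], and then the counts follow. *)
Lemma PaleyP D : (#|G| = 1 %[mod 4])%N -> 
  (is_Paley_PDS G D) <->
  [/\ D \subset G, (D^-1)%g = D, 1%g \notin D &
  forall z, z \in G -> gconv (psign D) (psign D) z = #|G|%:Z * (z == 1%g)%:R - 1].
Proof.
move=> G1.
have conv1 : (D^-1)%g = D -> 1%g \notin D ->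
    gconv (psign D) (psign D) 1 = #|G|%:Z - 1.
  move=> DV D1; rewrite /gconv (bigD1 1%g) //= psign_val // eqxx mul0r add0r.
  rewrite (eq_bigr (fun=> 1)) => [|x /andP[_ /negPf x1]]; last first.
    by rewrite mulg1 !psign_val // eq_invg1 x1 -{2}DV inE invgK; case: ifP.
  rewrite sumr_const (eq_card (B := G :\ 1%g)) => [|x]; last by rewrite !inE andbC.
  rewrite (natz #|_|); have := cardsD1 1%g G; rewrite group1 => ->.
  by rewrite addnC PoszD addrK.
split.
  case=> _ [[_ sDG cD lam mu] DV D1]; split=> // z Gz.
  have [->|z1] := eqVneq z 1%g; first by rewrite conv1 // mulr1.
  rewrite gconv_psign // psign_val // (negPf z1) cD.
  case: ifP => Dz; last by rewrite mu ?Dz //; move: #|G| G1 => n; lia.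
  (* A nonempty [D] excludes [#|G| = 1], the case in which [#|G| - 5] is truncated. *)
  have : (0 < #|D|)%N by apply/card_gt0P; exists z.
  by rewrite lam // cD; move: #|G| G1 => n; lia.
case=> sDG DV D1 cG; split=> //; split=> //.
have cD : (#|D| = (#|G| - 1) %/ 2)%N.
  have /eqP := gconv_sum_eq0 cG; rewrite sum_psign // => /eqP.
  by move: #|G| G1 #|D| => n ? k; lia.
have dc z : z \in G -> z != 1%g -> 4 * (diff_count D z)%:Z - 4 * #|D|%:Z +
  #|G|%:Z + 2 * psign D z = -1.
  by move=> Gz z1; rewrite -gconv_psign // cG // (negPf z1) mulr0 sub0r.
split=> // [z Dz z1|z Gz Dz z1].
  have : (0 < #|D|)%N by apply/card_gt0P; exists z.
  have := dc z (subsetP sDG _ Dz) z1; rewrite psign_val // (negPf z1) Dz cD.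
  by move: #|G| G1 (diff_count _ _) => n ? k; lia.
have := dc z Gz z1; rewrite psign_val // (negPf z1) (negPf Dz) cD.
by move: #|G| G1 (diff_count _ _) => n ? k; lia.
Qed.

End PaleySign.

Definition Paley_order (v : nat) : Prop :=
  exists (gT : finGroupType) (G : {group gT}) (D : {set gT}),
    [/\ abelian G, #|G| = v & is_Paley_PDS G D].

Lemma Paley_order_conv (V : finZmodType) (f : V -> int) :
  (#|V| = 1 %[mod 4])%N -> (forall x, f (- x) = f x) -> f 0 = 0 ->
  (forall x, x != 0 -> f x ^+ 2 = 1) ->
  (forall z, conv f f z = #|V|%:Z * (z == 0)%:R - 1) -> Paley_order #|V|.
Proof.
move=> V1 fN f0 f2 fc; pose D := [set x : V | f x == 1].
exists V, [set: V]%G, D; split; [exact: FinRing.zmod_abelian | by rewrite cardsT |].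
apply/PaleyP; first by rewrite cardsT.
have D1 : (1%g : V) \notin D by rewrite inE f0.
have DE : psign D =1 f.
  move=> x; rewrite psign_val // inE; have [->|/f2/sqr1_int[]->//] := eqVneq x 1%g.
  by rewrite f0.
split=> //; first exact: subsetT.
  by apply/setP=> x; rewrite mem_invg !inE fN.
move=> z _; rewrite cardsT -fc; apply: eq_big => [x|x _]; first by rewrite inE.
by rewrite !DE FinRing.zmodMgE FinRing.zmodVgE addrC.
Qed.

Lemma turyn_family_Paley n : (n = 1 %[mod 4])%N ->
  has_turyn_family n -> Paley_order n.
Proof.
move=> n1 [V [b0 [b1 [b2 [b3 [nE HV]]]]]].
have [v0 v1 v2 v3] := tf_0 HV.
pose h := (b0 \+ b1) \- (b2 \+ b3).
(* Product -1 means that one or three of the four signs are -1, so [h] is 2 or -2 off 0. *)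
have hE x : h x = 2 * (if x == 0 then 0 else if h x == 2 then 1 else -1).
  rewrite /h /=; have [->|/(tf_prod HV)] := eqVneq x 0.
    by rewrite v0 v1 v2 v3.
  have [/sqr1_int h0 /sqr1_int h1 /sqr1_int h2 /sqr1_int h3] := tf_sign HV x.
  by case: h0 => ->; case: h1 => ->; case: h2 => ->; case: h3 => ->.
pose f x : int := if x == 0 then 0 else if h x == 2 then 1 else -1.
rewrite -nE; apply: (@Paley_order_conv _ f); first by rewrite nE.
- move=> x; rewrite /f oppr_eq0 /h /=.
  by have [-> -> -> ->] := tf_even HV x.
- by rewrite /f eqxx.
- by move=> x /negPf x0; rewrite /f x0; case: ifP.
(* The squares contribute [4 v delta], the mixed terms [2 + 2 - 8]. *)
move=> z; have : conv h h z = 4 * (#|V|%:Z * (z == 0)%:R - 1).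
  rewrite /h !(convBl, convBr, convDl, convDr).
  rewrite ?(convC b1 b0) ?(convC b2 b0) ?(convC b3 b0) ?(convC b2 b1)
    ?(convC b3 b1) ?(convC b3 b2).
  rewrite (tf_conv01 HV) (tf_conv02 HV) (tf_conv03 HV) (tf_conv12 HV)
    (tf_conv13 HV) (tf_conv23 HV).
  by have := tf_sum HV z; case: (z == 0) => /=; lia.
rewrite (eq_conv hE hE) convZl convC convZl -/f; lia.
Qed.

(** * The quadratic character *)

Section QuadraticCharacter.
Variable F : finFieldType.
Hypothesis F1 : (#|F| = 1 %[mod 4])%N.
Implicit Types x y z : F.

(** The quadratic character, by Euler's criterion. *)
Definition chi (x : F) : int :=
  if x == 0 then 0 else if x ^+ (#|F| - 1)./2 == 1 then 1 else -1.

Lemma chi0 : chi 0 = 0. Proof. by rewrite /chi eqxx. Qed.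

Lemma chi1 : chi 1 = 1. Proof. by rewrite /chi oner_eq0 expr1n eqxx. Qed.

Lemma chi_sqr x : x != 0 -> chi x ^+ 2 = 1.
Proof. by rewrite /chi => /negPf ->; case: ifP. Qed.

Lemma half_card : (#|F| = (#|F| - 1)./2 + (#|F| - 1)./2 + 1)%N.
Proof. by move: #|F| F1 => q; lia. Qed.

Lemma expf_half x : x != 0 ->
  x ^+ (#|F| - 1)./2 = 1 \/ x ^+ (#|F| - 1)./2 = -1.
Proof.
move=> x0; have : x ^+ #|F| = x := expf_card x.
rewrite [in x ^+ _]half_card addn1 exprS => /eqP.
rewrite -[eqbRHS]mulr1 => /eqP/(mulfI x0).
rewrite addnn -muln2 exprM => /eqP; rewrite sqrf_eq1.
by case/orP=> /eqP ->; [left | right].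
Qed.

Lemma chiM x y : chi (x * y) = chi x * chi y.
Proof.
rewrite /chi mulf_eq0; have [->|x0] := eqVneq x 0; first by rewrite /= mul0r.
have [->|y0] := eqVneq y 0; first by rewrite orbT mulr0.
rewrite /= exprMn.
case: (expf_half x0) => ->; first by rewrite mul1r eqxx mul1r.
case: (expf_half y0) => ->; first by rewrite mulr1 eqxx mulr1.
by rewrite mulrNN mulr1 eqxx; case: ifP.
Qed.

(** Otherwise all [2 e] nonzero elements would be roots of [X^e - 1]. *)
Lemma chi_nonresidue : exists x, chi x = -1.
Proof.
set e := (#|F| - 1)./2.
have e0 : (0 < e)%N by have := card_finNzRing_gt1 F; have := F1; rewrite /e;
  move: #|F| => q; lia.
have [/existsP[x xP]|] := boolP [exists x : F, (x != 0) && (x ^+ e != 1)].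
  by exists x; case/andP: xP => /negPf x0 /negPf xe; rewrite /chi x0 xe.
rewrite negb_exists => /forallP nr; exfalso.
have p0 : 'X^e - 1 != 0 :> {poly F}.
  by rewrite -size_poly_gt0 -[1]/(1%:P) size_XnsubC.
have /(max_poly_roots p0) : all (root ('X^e - 1)) (enum (predC1 (0 : F))).
  apply/allP=> x; rewrite mem_enum inE => x0; have := nr x.
  by rewrite x0 negbK rootE !hornerE => /eqP ->; rewrite subrr.
rewrite enum_uniq -cardE cardC1 -[1]/(1%:P) size_XnsubC // => /(_ isT).
by have := half_card; rewrite -/e; move: #|F| e0 => q; lia.
Qed.

(** Multiplication by a nonresidue permutes the field and changes the sign of the sum. *)
Lemma sum_chi : \sum_x chi x = 0.
Proof.
have [b cb] := chi_nonresidue.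
have b0 : b != 0 by apply/eqP => b0; rewrite b0 chi0 in cb.
have : \sum_x chi x = - \sum_x chi x.
  rewrite {1}(reindex_inj (mulfI b0)) -sumrN.
  by apply: eq_bigr => x _; rewrite chiM cb mulN1r.
by lia.
Qed.

Lemma chiN x : chi (- x) = chi x.
Proof.
rewrite -mulN1r chiM {1}/chi oppr_eq0 oner_eq0 -signr_odd.
have -> : odd (#|F| - 1)./2 = false by move: #|F| F1 => q; lia.
by rewrite expr0 eqxx mul1r.
Qed.

(** For [z != 0] the term at [x != 0] is [chi (z / x - 1)], and [z / x - 1] runs over everything but
    -1; so the sum is [- chi (-1)]. *)
Lemma conv_chi z : conv chi chi z = #|F|%:Z * (z == 0)%:R - 1.
Proof.
have [->|z0] := eqVneq z 0.
  rewrite /conv (bigD1 0) //= chi0 mul0r add0r (eq_bigr (fun=> 1)); last first.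
    by move=> x x0; rewrite sub0r chiN -expr2 chi_sqr.
  rewrite sumr_const (eq_card (B := predC1 (0 : F))) // (natz #|_|) cardC1.
  by move: #|F| F1 => q; lia.
have e : \sum_(x | x != 0) chi (z / x - 1) = \sum_(x | x != -1) chi x.
  rewrite [RHS](reindex_onto (fun x => z / x - 1) (fun y => z / (y + 1))) /=.
    apply: eq_big => // x; rewrite subrK invfM invrK mulVKf ?z0 // eqxx andbT.
    by rewrite subr_eq addNr mulf_eq0 (negPf z0) invr_eq0.
  by move=> y; rewrite -subr_eq0 opprK => y1; rewrite invfM invrK mulVKf ?z0 //
    addrK.
rewrite mulr0 sub0r /conv (bigD1 0) //= chi0 mul0r add0r.
transitivity (\sum_(x | x != 0) chi (z / x - 1)).
  apply: eq_bigr => x x0; have -> : z - x = x * (z / x - 1).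
    by rewrite mulrBr mulr1 mulrC divfK.
  by rewrite chiM mulrA -expr2 chi_sqr // mul1r.
rewrite e; have := sum_chi; rewrite (bigD1 (-1)) //= chiN chi1 => /eqP.
by rewrite addrC addr_eq0 => /eqP.
Qed.

End QuadraticCharacter.

Lemma Paley_order_prime_power p m : prime p -> (0 < m)%N ->
  (p ^ m = 1 %[mod 4])%N -> Paley_order (p ^ m).
Proof.
move=> p_pr m0 v1; have [F _ cF] := pPrimePowerField p_pr m0.
have F1 : (#|F| = 1 %[mod 4])%N by rewrite cF.
rewrite -cF; apply: (@Paley_order_conv F (@chi F)) => //.
- exact: chiN.
- exact: chi0.
- exact: chi_sqr.
- exact: conv_chi.
Qed.

(** * Lines and half-lines in a finite plane *)

Section Lines.
Variable K : finFieldType.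
Implicit Types (m n : option K) (v w z : K * K) (l : K).

(* [option K] is the projective line over [K], with [None] at infinity; it indexes
   the lines through [0] of [K * K]. *)
Definition det v w : K := v.1 * w.2 - v.2 * w.1.
Definition smul l v : K * K := (l * v.1, l * v.2).
Definition rep m : K * K := if m is Some y then (1, y) else (0, 1).
(* Chosen so that [det (rep m) (corep m) = 1]. *)
Definition corep m : K * K := if m is Some y then (0, 1) else (-1, 0).
Definition line v : option K := if v.1 == 0 then None else Some (v.2 / v.1).
Definition ell m v : int := (det (rep m) v == 0)%:R.

Lemma detB v w z : det v (w - z) = det v w - det v z.
Proof. by rewrite /det /=; ring. Qed.

Lemma detNr v w : det v (- w) = - det v w.
Proof. by rewrite /det /=; ring. Qed.

Lemma detZr l v w : det v (smul l w) = l * det v w.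
Proof. by rewrite /det /=; ring. Qed.

Lemma detNC v w : det v w = - det w v.
Proof. by rewrite /det /=; ring. Qed.

Lemma detvv v : det v v = 0.
Proof. by rewrite /det /=; ring. Qed.

Lemma ell_smul m l : ell m (smul l (rep m)) = 1.
Proof. by rewrite /ell detZr detvv mulr0 eqxx. Qed.

Lemma det_corep m l : det (smul l (rep m)) (corep m) = l.
Proof. by case: m => [y|]; rewrite /det /=; ring. Qed.

Lemma on_line m v : det (rep m) v = 0 -> v = smul (det v (corep m)) (rep m).
Proof.
case: m v => [y|] [a b]; rewrite /det /smul /= => /eqP.
  by rewrite mul1r subr_eq0 => /eqP ->; congr pair; ring.
rewrite mul0r mul1r sub0r oppr_eq0 => /eqP ->; congr pair; ring.
Qed.

Lemma det_rep_neq0 m n : m != n -> det (rep m) (rep n) != 0.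
Proof.
case: m n => [x|] [y|] //= mn; rewrite /det /= ?mul1r ?mulr1 ?mul0r ?mulr0.
- by rewrite subr_eq0; apply: contraNneq mn => ->.
- by rewrite subr0 oner_eq0.
- by rewrite sub0r oppr_eq0 oner_eq0.
Qed.

Lemma lineE v : v != 0 -> exists2 l, l != 0 & v = smul l (rep (line v)).
Proof.
case: v => a b; rewrite /line /smul /=; have [->|a0 _] := eqVneq a 0.
  rewrite xpair_eqE eqxx /= => b0; exists b => //.
  by rewrite mulr0 mulr1.
by exists a; rewrite // mulr1 mulrC divfK.
Qed.

Lemma ell_line m v : v != 0 -> ell m v = (m == line v)%:R.
Proof.
move=> v0; have [l l0 vE] := lineE v0; rewrite {1}vE /ell detZr mulf_eq0 (negPf
  l0) /=.
have [->|mn] := eqVneq m (line v); first by rewrite detvv eqxx.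
by rewrite (negPf (det_rep_neq0 mn)).
Qed.

Lemma ell0 m : ell m 0 = 1.
Proof. by rewrite /ell /det /= !mulr0 subrr eqxx. Qed.

Lemma ellN m v : ell m (- v) = ell m v.
Proof. by rewrite /ell detNr oppr_eq0. Qed.

Lemma sum_ell z : \sum_m ell m z = 1 + #|K|%:Z * (z == 0)%:R.
Proof.
have [->|z0] := eqVneq z 0.
  rewrite (eq_bigr (fun=> 1)) => [|m _]; last exact: ell0.
  by rewrite sumr_const card_option (natz _.+1) mulr1.
rewrite (bigD1 (line z)) //= ell_line // eqxx big1 ?addr0 ?mulr0 // => m mz.
by rewrite ell_line // (negPf mz).
Qed.

Lemma sum_on_line m (f : K * K -> int) :
  \sum_v ell m v * f v = \sum_l f (smul l (rep m)).
Proof.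
rewrite (bigID (fun v => det (rep m) v == 0)) /= addrC big1 => [|v /negPf v0];
  last first.
  by rewrite /ell v0 mul0r.
rewrite add0r (reindex_onto (fun l => smul l (rep m)) (fun v =>
  det v (corep m))) /=.
  apply: eq_big => [l|l _]; last by rewrite ell_smul mul1r.
  by rewrite detZr detvv mulr0 det_corep !eqxx.
by move=> v /eqP/on_line <-.
Qed.

(** The line [m] meets the coset of the line [n] through [z] in one point, whose coordinate is given
    by Cramer's rule. *)
Lemma sum_transversal m n (f : K -> int) z : m != n ->
  \sum_l ell n (z - smul l (rep m)) * f l
    = f (det (rep n) z / det (rep n) (rep m)).
Proof.
rewrite eq_sym => mn; have d0 := det_rep_neq0 mn.
rewrite (bigD1 (det (rep n) z / det (rep n) (rep m))) //= big1 => [|l lz].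
  by rewrite /ell detB detZr divfK // subrr eqxx mul1r addr0.
rewrite /ell detB detZr subr_eq0; case: eqP => [e|_]; last by rewrite mul0r.
by rewrite e mulfK ?eqxx in lz.
Qed.

Lemma conv_ell m n z :
  conv (ell m) (ell n) z = 1 + (m == n)%:R * (#|K|%:Z * ell m z - 1).
Proof.
rewrite /conv sum_on_line; have [<-|mn] := eqVneq m n.
  rewrite (eq_bigr (fun=> ell m z)) => [|l _]; last first.
    by rewrite /ell detB detZr detvv mulr0 subr0.
  by rewrite sumr_const -(mulr_natl (ell m z)) (natz #|_|) mul1r addrC subrK.
have := sum_transversal (fun=> 1) z mn; under eq_bigr do rewrite mulr1.
by move=> ->; rewrite mul0r addr0.
Qed.

Hypothesis K1 : (#|K| = 1 %[mod 4])%N.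

Definition half_line m v : int := ell m v * chi (det v (corep m)).

Lemma half_line_smul m l : half_line m (smul l (rep m)) = chi l.
Proof. by rewrite /half_line ell_smul det_corep mul1r. Qed.

Lemma conv_half_line m f z :
  conv (half_line m) f z = \sum_l chi l * f (z - smul l (rep m)).
Proof.
rewrite /conv -(eq_bigr _ (fun x _ => mulrA _ _ _)) sum_on_line.
by apply: eq_bigr => l _; rewrite det_corep.
Qed.

Lemma chi_div (x y : K) : chi (x / y) = chi x * chi y.
Proof.
have [->|y0] := eqVneq y 0; first by rewrite invr0 mulr0 chi0 mulr0.
by rewrite -[x in RHS](divfK y0) (chiM K1 _ y) -mulrA -expr2 chi_sqr ?mulr1.
Qed.

(** Distinct lines leave the single term of [sum_transversal]. For [m = n] the sum vanishes by
    [sum_chi], in accordance with [det (rep n) (rep m) = 0]. *)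
Lemma conv_half_line_ell m n z : conv (half_line m) (ell n) z
  = chi (det (rep n) z) * chi (det (rep n) (rep m)).
Proof.
rewrite conv_half_line; have [<-|mn] := eqVneq m n.
  rewrite detvv chi0 mulr0 (eq_bigr (fun l => chi l * ell m z)) => [|l _].
    by rewrite -mulr_suml sum_chi // mul0r.
  by rewrite /ell detB detZr detvv mulr0 subr0.
by under eq_bigr do rewrite mulrC; rewrite sum_transversal // chi_div.
Qed.

Lemma chi_det_sqr m z : chi (det (rep m) z) ^+ 2 = 1 - ell m z.
Proof.
by rewrite /ell; case: eqP => [->|/eqP/chi_sqr-> //]; rewrite chi0 expr0n.
Qed.

(** For distinct lines [z] splits uniquely, with coordinates [det (rep n) z] and [det (rep m) z]
    over determinants that are equal up to sign, so their characters cancel. For equal lines it is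
    [conv_chi] along the line; [chi_det_sqr] makes one formula serve on and off it. *)
Lemma conv_half_lines m n z : conv (half_line m) (half_line n) z
  = chi (det (rep m) z) * chi (det (rep n) z)
    + (m == n)%:R * (#|K|%:Z * (z == 0)%:R - 1).
Proof.
rewrite conv_half_line; have [<-|mn] := eqVneq m n.
  rewrite -expr2 chi_det_sqr mul1r.
  have [/eqP/on_line zE|zn] := boolP (det (rep m) z == 0); last first.
    rewrite big1 => [|l _]; last first.
      by rewrite /half_line /ell detB detZr detvv mulr0 subr0 (negPf zn) mul0r
        mulr0.
    have z0 : z == 0 = false by apply: contraNF zn => /eqP ->;
      rewrite /det /= !mulr0 subrr.
    by rewrite /ell (negPf zn) z0; lia.
  move: (det z (corep m)) zE => a ->.
  transitivity (conv (@chi K) (@chi K) a).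
    apply: eq_bigr => l _; congr (_ * _).
    have -> : smul a (rep m) - smul l (rep m) = smul (a - l) (rep m).
      by rewrite /smul !mulrBl.
    by rewrite half_line_smul.
  rewrite conv_chi // ell_smul.
  have -> : (smul a (rep m) == 0) = (a == 0).
    apply/eqP/eqP => [a0|->]; last by rewrite /smul !mul0r.
    by rewrite -(det_corep m a) a0 /det !mul0r subrr.
  by ring.
rewrite mul0r addr0.
under eq_bigr => l _ do rewrite /half_line mulrCA.
rewrite (sum_transversal (fun l => chi l * chi (det (z - smul l (rep m)) (corep
  n)))) //.
rewrite [in LHS]/=; set w := (X in det X (corep n)).
have dw : det (rep n) w = 0.
  by rewrite /w detB detZr divfK ?subrr // det_rep_neq0 // eq_sym.
have := congr1 (det (rep m)) (on_line dw).
rewrite detZr {1}/w detB detZr detvv mulr0 subr0 => ->.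
by rewrite chi_div (chiM K1) (detNC (rep n) (rep m)) chiN //; ring.
Qed.

End Lines.

(** * A Turyn family of order 9 *)

Lemma sum1_finType (T : finType) : \sum_(x : T) 1 = #|T|%:Z.
Proof. by rewrite -natz -sum1_card natr_sum; apply: eq_bigr. Qed.

Lemma sum_option (T : finType) (f : option T -> int) :
  \sum_m f m = f None + \sum_x f (Some x).
Proof.
rewrite (bigD1 None) //=; congr (_ + _).
rewrite (reindex_omap Some id) /=; last by case.
by apply: eq_bigl => x; rewrite eqxx.
Qed.

Lemma has_turyn_family9 : has_turyn_family 9.
Proof.
have [K _ cK] := @pPrimePowerField 3 1 isT isT.
rewrite expn1 in cK; have cPG : 4%N = #|{: option K}| by rewrite card_option cK.
pose m (i : 'I_4) : option K := enum_val (cast_ord cPG i).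
have mE i j : (m i == m j) = (i == j).
  by rewrite (inj_eq enum_val_inj) (inj_eq (@cast_ord_inj _ _ _)).
have m_bij : bijective m.
  by apply: inj_card_bij => [i j /eqP|]; rewrite ?mE ?card_ord -?cPG // => /eqP.
have sum4 (f : option K -> int) :
    \sum_n f n = f (m ord0) + f (m (inord 1)) + f (m (inord 2)) + f (m (inord 3)).
  rewrite (reindex m) /=; last exact: onW_bij.
  rewrite !big_ord_recl big_ord0 addr0 !addrA.
  by congr (f (m _) + f (m _) + f (m _) + f (m _)); apply/val_inj;
    rewrite /= ?inordK.
pose b n (v : K * K) : int := 2 * ell n v - 1.
have bE n : b n =1 (fun v => 2 * ell n v) \- (fun=> 1) by [].
have ell1 (n : option K) z : conv (ell n) (fun=> 1) z = 3.
  by rewrite /conv sum_on_line sum1_finType cK.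
have conv11 z : conv (fun=> 1 : int) (fun _ : K * K => 1) z = 9.
  by rewrite /conv (eq_bigr (fun=> 1)) // sum1_finType card_prod cK.
have convb k n z :
    conv (b k) (b n) z = 1 + (k == n)%:R * (12 * ell k z - 4).
  rewrite (eq_conv (bE k) (bE n)) !(convBl, convBr) !convZl.
  rewrite (convC (ell k)) (convC (fun=> 1) (fun v => _ * _)) !convZl.
  by rewrite (convC (ell n)) !ell1 conv11 conv_ell cK; ring.
exists (K * K)%type, (b (m ord0)), (b (m (inord 1))), (b (m (inord 2))),
  (b (m (inord 3))).
split; first by rewrite card_prod cK.
split=> [x|x||x x0|z|z|z|z|z|z|z]; rewrite ?convb ?mE -?val_eqE /= ?inordK //
  ?mul0r ?addr0 //.
- by rewrite /b !ellN.
- have b2 n : b n x ^+ 2 = 1 by rewrite /b /ell; case: eqP.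
  by split.
- by split; rewrite /b ell0.
(* A nonzero [x] lies on exactly one of the four lines, so three of the signs are -1. *)
- have := sum4 (fun n => ell n x); rewrite sum_ell (negPf x0) mulr0 addr0.
  by rewrite /b /ell; do 4!case: (_ == 0).
have := sum4 (fun n => ell n z); rewrite sum_ell cK !eqxx card_prod cK.
by case: (z == 0) => /=; lia.
Qed.

(** * Turyn families from signed lines and half-lines *)

Lemma sum_diag (I : finType) (f g : I -> int) (h : I -> int) :
  \sum_m \sum_n f m * g n * ((m == n)%:R * h m) = \sum_m f m * g m * h m.
Proof.
apply: eq_bigr => m _; rewrite (bigD1 m) //= eqxx mul1r big1 ?addr0 // => n nm.
by rewrite eq_sym (negPf nm) mul0r mulr0.
Qed.

Lemma conv_sum2 (V : finZmodType) (I : finType) (f g : I -> int) (F G :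
  I -> V -> int) z :
  conv (fun v => \sum_m f m * F m v) (fun v => \sum_m g m * G m v) z
  = \sum_m \sum_n f m * g n * conv (F m) (G n) z.
Proof.
rewrite conv_suml; apply: eq_bigr => m _; rewrite convZl conv_sumr mulr_sumr.
by apply: eq_bigr => n _; rewrite convC convZl convC mulrA.
Qed.

Lemma sum_mul2 (I : finType) (f g : I -> int) :
  \sum_m \sum_n f m * g n = (\sum_m f m) * (\sum_n g n).
Proof. by rewrite mulr_suml; apply: eq_bigr => m _; rewrite mulr_sumr. Qed.

Section TurynFamilyOnPlane.
(** [gA] and [gB] stand for half the sum and half the difference of eigenvectors of the conference
    matrix for [r] and [-r], which is why the matrix exchanges them up to the factor [r]. The signs
    [eps] add up to 1 over each of the two supports. *)
Variables (K : finFieldType) (r : int) (gA gB eps : option K -> int).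
Hypotheses (K1 : (#|K| = 1 %[mod 4])%N) (Kr : #|K|%:Z = r ^+ 2).
Hypothesis gAB : forall m, gA m ^+ 2 = 1 /\ gB m = 0 \/ gA m = 0 /\ gB m ^+ 2 = 1.
Hypothesis SgA : forall n, \sum_m gA m * chi (det (rep m) (rep n)) = r * gB n.
Hypothesis SgB : forall n, \sum_m gB m * chi (det (rep m) (rep n)) = r * gA n.
Hypothesis eps2 : forall m, eps m ^+ 2 = 1.
Hypothesis epsA : \sum_m eps m * gA m ^+ 2 = 1.
Hypothesis epsB : \sum_m eps m * gB m ^+ 2 = 1.
Hypothesis cA : 2 * \sum_m gA m ^+ 2 = #|K|%:Z + 1.
Hypothesis cB : 2 * \sum_m gB m ^+ 2 = #|K|%:Z + 1.

Let wlines (w : option K -> int) (v : K * K) : int := \sum_m w m * ell m v.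
Let wsigns (g : option K -> int) (v : K * K) : int := \sum_m g m * half_line m v.
(** The conference matrix applied to [g], extended from the representatives [rep n] to all
    vectors. *)
Let S (g : option K -> int) (v : K * K) : int := \sum_m g m * chi (det (rep m) v).

Lemma conv_wlines w w' z : conv (wlines w) (wlines w') z
  = (\sum_m w m) * (\sum_m w' m) + #|K|%:Z * (\sum_m w m * w' m * ell m z)
    - \sum_m w m * w' m.
Proof.
rewrite conv_sum2; under eq_bigr do under eq_bigr do rewrite conv_ell // mulrDr
  mulr1.
under eq_bigr do rewrite big_split /=.
rewrite big_split /= sum_mul2 sum_diag -addrA; congr (_ + _).
rewrite mulr_sumr -sumrB; apply: eq_bigr => m _; ring.
Qed.

Lemma conv_wsigns g g' z : conv (wsigns g) (wsigns g') z
  = S g z * S g' z + (\sum_m g m * g' m) * (#|K|%:Z * (z == 0)%:R - 1).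
Proof.
rewrite conv_sum2 /S -sum_mul2 mulr_suml.
rewrite -(sum_diag g g' (fun=> #|K|%:Z * (z == 0)%:R - 1)) -big_split.
apply: eq_bigr => m _; rewrite -big_split; apply: eq_bigr => n _ /=.
by rewrite conv_half_lines //; ring.
Qed.

Lemma conv_wsigns_lines g w z : conv (wsigns g) (wlines w) z
  = \sum_m w m * chi (det (rep m) z) * S g (rep m).
Proof.
rewrite conv_sum2 exchange_big /=; apply: eq_bigr => m _.
rewrite /S mulr_sumr; apply: eq_bigr => n _.
by rewrite conv_half_line_ell // (detNC (rep m) (rep n)) chiN //; ring.
Qed.

Lemma S_smul g l v : S g (smul l v) = chi l * S g v.
Proof.
by rewrite /S mulr_sumr; apply: eq_bigr => m _; rewrite detZr chiM // mulrCA.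
Qed.

Lemma wlines_line (w : option K -> int) z : z != 0 -> wlines w z = w (line z).
Proof.
move=> z0; rewrite /wlines (bigD1 (line z)) //= ell_line // eqxx mulr1 big1
  ?addr0 //.
by move=> m mz; rewrite ell_line // (negPf mz) mulr0.
Qed.

Lemma wlines0 (w : option K -> int) : wlines w 0 = \sum_m w m.
Proof. by apply: eq_bigr => m _; rewrite ell0 mulr1. Qed.

Lemma S_sqr (g g' : option K -> int) z :
  (forall n, \sum_m g m * chi (det (rep m) (rep n)) = r * g' n) ->
  S g z ^+ 2 = #|K|%:Z * (wlines (fun m => g' m ^+ 2) z
    - (\sum_m g' m ^+ 2) * (z == 0)%:R).
Proof.
move=> Sg; have [->|z0] := eqVneq z 0.
  rewrite wlines0 mulr1 subrr mulr0 /S big1 ?expr0n // => m _.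
  by rewrite /det !mulr0 subrr chi0 mulr0.
rewrite mulr0 subr0 wlines_line // Kr; have [l l0 zE] := lineE z0.
by rewrite {1}zE S_smul exprMn chi_sqr // mul1r /S Sg exprMn.
Qed.

Lemma wsigns_line z : z != 0 ->
  exists2 c, c ^+ 2 = 1 & forall g, wsigns g z = g (line z) * c.
Proof.
move=> z0; have [l l0 zE] := lineE z0; exists (chi l) => [|g]; first exact: chi_sqr.
rewrite /wsigns (bigD1 (line z)) //= [X in half_line _ X]zE half_line_smul big1
  ?addr0 // => m mz.
by rewrite /half_line ell_line // (negPf mz) mul0r mulr0.
Qed.

Lemma wsigns0 g : wsigns g 0 = 0.
Proof.
rewrite /wsigns big1 // => m _.
by rewrite /half_line /det !mul0r subrr chi0 !mulr0.
Qed.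

Lemma wlinesN w v : wlines w (- v) = wlines w v.
Proof. by apply: eq_bigr => m _; rewrite ellN. Qed.

Lemma wsignsN g v : wsigns g (- v) = wsigns g v.
Proof.
by apply: eq_bigr => m _; rewrite /half_line ellN detNC detNr opprK detNC chiN.
Qed.

(** The family is [X - GA, X + GA, Y - GB, Y + GB], where [X] carries the lines in the support of
    [gB] and [GA] the half-lines in that of [gA], and vice versa for [Y] and [GB]. So off 0 just one
    summand is nonzero. The conditions reduce to [X * X = 1 + GA * GA], its analogue for [Y],
    [X * Y = 1], and the vanishing of [GA * GB], [GB * X] and [GA * Y]. *)
Lemma turyn_family_plane : has_turyn_family (#|K| ^ 2).
Proof.
pose wA m := eps m * gA m ^+ 2; pose wB m := eps m * gB m ^+ 2.
pose X := wlines wB; pose Y := wlines wA.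
pose GA := wsigns gA; pose GB := wsigns gB.
have gAgB m : gA m * gB m = 0.
  by case: (gAB m) => -[hA hB]; [rewrite hB mulr0 | rewrite hA mul0r].
have wAB m : wA m * wB m = 0.
  by rewrite /wA /wB mulrACA -exprMn gAgB expr0n mulr0.
have wA2 m : wA m * wA m = gA m ^+ 2.
  rewrite /wA; case: (gAB m) => -[h _]; rewrite h.
    by rewrite mulr1 -expr2 eps2.
  by rewrite expr0n mulr0 mulr0.
have wB2 m : wB m * wB m = gB m ^+ 2.
  rewrite /wB; case: (gAB m) => -[_ h]; rewrite h;
    last by rewrite mulr1 -expr2 eps2.
  by rewrite expr0n mulr0 mulr0.
have XXE z : conv X X z = 1 + #|K|%:Z * wlines (fun m => gB m ^+ 2) z
    - \sum_m gB m ^+ 2.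
  rewrite conv_wlines epsB (eq_bigr (fun m => gB m ^+ 2 * ell m z)) => [|m _];
    last by rewrite wB2.
  by have -> : \sum_m wB m * wB m = \sum_m gB m ^+ 2 by apply: eq_bigr.
(* By [SgA] the square of [S gA] is [#|K|] times the indicator of the lines supporting [gB], off 0;
   this is the term that [X * X] has. *)
have XX z : conv X X z = 1 + conv GA GA z.
  rewrite XXE conv_wsigns -(expr2 (S _ _)) (S_sqr z SgA).
  have -> : \sum_m gA m * gA m = \sum_m gA m ^+ 2 by [].
  move: cA cB; move: (wlines _ _) (\sum_m gA m ^+ 2) (\sum_m gB m ^+ 2).
  by move=> w a b ha hb; rewrite (_ : b = a); [ring | lia].
have YYE z : conv Y Y z = 1 + #|K|%:Z * wlines (fun m => gA m ^+ 2) z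
    - \sum_m gA m ^+ 2.
  rewrite conv_wlines epsA (eq_bigr (fun m => gA m ^+ 2 * ell m z)) => [|m _];
    last by rewrite wA2.
  by have -> : \sum_m wA m * wA m = \sum_m gA m ^+ 2 by apply: eq_bigr.
have YY z : conv Y Y z = 1 + conv GB GB z.
  rewrite YYE conv_wsigns -(expr2 (S _ _)) (S_sqr z SgB).
  have -> : \sum_m gB m * gB m = \sum_m gB m ^+ 2 by [].
  move: cA cB; move: (wlines _ _) (\sum_m gA m ^+ 2) (\sum_m gB m ^+ 2).
  by move=> w a b ha hb; rewrite (_ : b = a); [ring | lia].
have XY z : conv X Y z = 1.
  rewrite conv_wlines epsA epsB !big1 => [|m _|m _];
    rewrite ?(mulrC (wB m)) ?wAB ?mul0r //.
  by rewrite mulr0 addr0 subr0.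
have SAB z : S gA z * S gB z = 0.
  have [->|z0] := eqVneq z 0.
    by rewrite /S big1 ?mul0r // => m _; rewrite /det !mulr0 subrr chi0 mulr0.
  have [l _ ->] := lineE z0; rewrite !S_smul /S SgA SgB mulrACA [X in _ * X]mulrACA.
  by rewrite (mulrC (gB _)) gAgB !mulr0.
have GAGB z : conv GA GB z = 0.
  by rewrite conv_wsigns SAB big1 ?mul0r.
(* The matrix moves [gB] to the support of [gA], where the weights of [X] vanish. *)
have XGB z : conv GB X z = 0.
  rewrite conv_wsigns_lines big1 // => m _; rewrite /S SgB /wB.
  transitivity (eps m * gB m * chi (det (rep m) z) * r * (gA m * gB m));
    first by ring.
  by rewrite gAgB mulr0.
have YGA z : conv GA Y z = 0.
  rewrite conv_wsigns_lines big1 // => m _; rewrite /S SgA /wA.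
  transitivity (eps m * gA m * chi (det (rep m) z) * r * (gA m * gB m));
    first by ring.
  by rewrite gAgB mulr0.
exists (K * K)%type, (X \- GA), (X \+ GA), (Y \- GB), (Y \+ GB).
split; first by rewrite card_prod.
split=> [x|x||x x0|z|z|z|z|z|z|z].
all: cycle 4.
1-6: rewrite !(convBl, convBr, convDl, convDr) ?(convC GA X) ?(convC X GB)
  ?(convC Y GB) ?XX ?XY ?YY ?YGA ?XGB ?GAGB.
1-6: try by move: (conv X GA z) (conv GB Y z) (conv GA GA z) (conv GB GB z) =>
  a b c d; lia.
- have : conv X X z + conv Y Y z = 1 + #|K|%:Z ^+ 2 * (z == 0)%:R.
    rewrite XXE YYE.
    have : wlines (fun m => gA m ^+ 2) z + wlines (fun m => gB m ^+ 2) z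
        = 1 + #|K|%:Z * (z == 0)%:R.
      rewrite -sum_ell -big_split; apply: eq_bigr => m _ /=.
      by case: (gAB m) => -[hA hB]; rewrite hA hB; ring.
    move: cA cB; move: (wlines _ _) (wlines _ _).
    move: (\sum_m gA m ^+ 2) (\sum_m gB m ^+ 2).
    by move=> a b w w' ha hb /(canRL (addrK _)) ->; lia.
  rewrite card_prod PoszM XX YY !(convBl, convBr, convDl, convDr) XX YY.
  rewrite (convC GA X) (convC GB Y) /=.
  rewrite -[4 * _ * _]mulrA -expr2; move: (_ ^+ 2 * _) => e.
  by move: (conv X GA z) (conv Y GB z) (conv GA GA z) (conv GB GB z) =>
    a b c d; lia.
- by split; rewrite /= /X /Y /GA /GB wlinesN wsignsN.
- have [->|x0] := eqVneq x 0.
    by rewrite /= /X /Y /GA /GB !wsigns0 !wlines0 epsA epsB.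
  rewrite /= /X /Y /GA /GB !wlines_line //; have [c c2 cE] := wsigns_line x0.
  rewrite !cE /wA /wB; have := eps2 (line x).
  by case: (gAB (line x)) => -[hA hB]; rewrite hA hB => e2; split;
    rewrite ?(expr0n, mulr0, mul0r, mulr1, subr0, addr0, sub0r, add0r, sqrrN)
      ?exprMn ?hA ?hB ?c2 ?mulr1.
- by rewrite /= /X /Y /GA /GB !wsigns0 !wlines0 epsA epsB.
rewrite /= /X /Y /GA /GB !wlines_line //; have [c c2 cE] := wsigns_line x0.
rewrite !cE /wA /wB; have e2 := eps2 (line x).
case: (gAB (line x)) => -[hA hB].
  transitivity ((gA (line x) ^+ 2 * c ^+ 2)
    * - (eps (line x) ^+ 2 * gA (line x) ^+ 2 ^+ 2)).
    by rewrite hB; ring.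
  by rewrite hA e2 c2.
transitivity ((gB (line x) ^+ 2 * c ^+ 2)
  * - (eps (line x) ^+ 2 * gB (line x) ^+ 2 ^+ 2)).
  by rewrite hA; ring.
by rewrite hB e2 c2.
Qed.

End TurynFamilyOnPlane.

(** * Quadratic extensions and Turyn families of order [n ^ 4] *)

Lemma sum_alternating n : \sum_(0 <= i < n) (-1) ^+ i = (odd n)%:R :> int.
Proof.
elim: n => [|n IHn]; first by rewrite big_geq.
by rewrite big_nat_recr //= IHn -signr_odd; case: (odd n).
Qed.

(** Alternate the signs along an enumeration of [A]. *)
Lemma balanced_signs (T : finType) (A : {set T}) : odd #|A| ->
  exists2 e : T -> int, forall x, e x ^+ 2 = 1 & \sum_(x in A) e x = 1.
Proof.
move=> oA; exists (fun x => (-1) ^+ index x (enum A)) => [x|].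
  by rewrite sqrr_sign.
have /card_gt0P[x0 _] : (0 < #|A|)%N by case: #|A| oA.
rewrite -big_enum /= (big_nth x0) -cardE.
rewrite (eq_big_nat _ _ (F2 := fun i => (-1) ^+ i)) ?sum_alternating ?oA // => i.
by case/andP=> _ iA; rewrite index_uniq ?enum_uniq // -cardE.
Qed.

Lemma odd_sqr_mod4 n : odd n -> (n ^ 2 = 1 %[mod 4])%N.
Proof.
move=> on; rewrite -(odd_double_half n) on; set k := n./2.
have -> : ((1 + k.*2) ^ 2 = (k ^ 2 + k) * 4 + 1)%N by nia.
by rewrite modnMDl.
Qed.

Lemma sum_nonzero_const (F : finFieldType) (c : int) :
  \sum_(x : F | x != 0) c = (#|F|%:Z - 1) * c.
Proof.
rewrite -sum1_finType [in RHS](bigD1 0) //= [_ + _ - 1]addrAC subrr add0r.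
by rewrite mulr_suml; apply: eq_bigr => x _; rewrite mul1r.
Qed.

Section QuadraticExtension.
Variables (F K : finFieldType) (i : {rmorphism F -> K}).
Hypotheses (oF : odd #|F|) (cK : #|K| = (#|F| ^ 2)%N).

Let K1 : (#|K| = 1 %[mod 4])%N.
Proof. by rewrite cK odd_sqr_mod4. Qed.

(** Elements of [F] are squares in [K]: with [q = #|F|], the exponent [(q^2 - 1) / 2] is a multiple
    of [q - 1]. *)
Lemma chi_subfield s : s != 0 -> chi (i s) = 1.
Proof.
move=> s0; rewrite /chi fmorph_eq0 (negPf s0) -rmorphXn.
have e : ((#|K| - 1)./2 = (#|F| - 1) * (#|F| + 1)./2)%N.
  rewrite cK.
  have [k ->] : exists k, #|F| = k.*2.+1.
    by exists #|F|./2; rewrite -[LHS]odd_double_half oF.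
  have -> : (k.*2.+1 ^ 2 - 1 = (k.*2 * k.+1).*2)%N by nia.
  by rewrite addn1 -doubleS subn1 !doubleK.
have sF : s ^+ (#|F| - 1) = 1.
  apply: (mulfI s0); rewrite mulr1 -exprS subn1 prednK ?expf_card //.
  exact: ltnW (card_finNzRing_gt1 F).
by rewrite e exprM sF expr1n rmorph1 eqxx.
Qed.

Variable beta : K.
Hypothesis chi_beta : chi beta = -1.

Definition coord (x : F * F) : K := i x.1 + beta * i x.2.

(** [F] and [beta F] meet only in 0, since [chi] is 1 on nonzero elements of the first and -1 on
    those of the second. *)
Lemma coord_bij : bijective coord.
Proof.
apply: inj_card_bij; last by rewrite card_prod cK.
move=> [s t] [s' t']; rewrite /coord /= => e.
have {}e : beta * i (t - t') = i (s' - s).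
  rewrite !rmorphB; transitivity (i s' + beta * i t' - i s - beta * i t').
    by rewrite -e; ring.
  by ring.
have [tt|tt] := eqVneq t t'.
  move: e; rewrite tt subrr rmorph0 mulr0 => /esym/eqP.
  by rewrite fmorph_eq0 subr_eq0 => /eqP ->.
have := congr1 (@chi K) e; rewrite chiM // chi_beta chi_subfield ?subr_eq0 // mulr1.
have [->|ss] := eqVneq s' s; first by rewrite subrr rmorph0 chi0.
by rewrite chi_subfield // subr_eq0.
Qed.

Lemma sum_coord (f : K -> int) : \sum_y f y = \sum_s \sum_t f (i s + beta * i t).
Proof.
rewrite (reindex coord) /=; last exact/onW_bij/coord_bij.
by rewrite pair_big.
Qed.

(** For [t != 0], scaling by [t] shows that the sum does not depend on [t]; its value follows since
    [chi] sums to 0 over [K] and to [#|F| - 1] over [F]. *)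
Lemma sum_chi_row t :
  \sum_s chi (i s + beta * i t) = #|F|%:Z * (t == 0)%:R - 1.
Proof.
have T0 : \sum_s chi (i s) = #|F|%:Z - 1.
  rewrite (bigD1 0) //= rmorph0 chi0 add0r (eq_bigr (fun=> 1)) =>
    [|s /chi_subfield //].
  by rewrite sum_nonzero_const mulr1.
have T1 t' : t' != 0 ->
    \sum_s chi (i s + beta * i t') = \sum_s chi (i s + beta).
  move=> t0; rewrite (reindex_inj (mulIf t0)); apply: eq_bigr => s _.
  by rewrite rmorphM -mulrDl chiM // chi_subfield // mulr1.
have [->|t0] := eqVneq t 0.
  by rewrite mulr1 -T0; apply: eq_bigr => s _; rewrite rmorph0 mulr0 addr0.
rewrite mulr0 sub0r T1 //.
have := sum_chi K1; rewrite sum_coord exchange_big (bigD1 0) //=.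
rewrite (eq_bigr (fun s => chi (i s))) => [|s _];
  last by rewrite rmorph0 mulr0 addr0.
rewrite T0 (eq_bigr (fun=> \sum_s chi (i s + beta))) => [|s /T1 //].
have F1 : #|F|%:Z - 1 != 0 by rewrite subr_eq0 -[1]/(1%:Z) eqz_nat gtn_eqF
  ?card_finNzRing_gt1.
rewrite sum_nonzero_const -{1}[_ - 1]mulr1 -mulrDr => /eqP.
rewrite mulf_eq0 (negPf F1) /= addr_eq0 => /eqP h; apply: oppr_inj.
by rewrite opprK -h.
Qed.

(** As for rows, with [beta F], whose nonzero elements are nonsquares, in place of [F]. *)
Lemma sum_chi_col s :
  \sum_t chi (i s + beta * i t) = 1 - #|F|%:Z * (s == 0)%:R.
Proof.
have T0 : \sum_t chi (beta * i t) = 1 - #|F|%:Z.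
  under eq_bigr do rewrite chiM // chi_beta.
  rewrite -mulr_sumr; have := sum_chi_row 0.
  rewrite eqxx mulr1; under eq_bigr do rewrite rmorph0 mulr0 addr0.
  by move=> ->; ring.
have T1 s' : s' != 0 ->
    \sum_t chi (i s' + beta * i t) = \sum_t chi (1 + beta * i t).
  move=> s0; rewrite (reindex_inj (mulIf s0)); apply: eq_bigr => t _.
  by rewrite rmorphM mulrA -[X in X + _]mul1r -mulrDl chiM // chi_subfield // mulr1.
have [->|s0] := eqVneq s 0.
  by rewrite mulr1 -T0; apply: eq_bigr => t _; rewrite rmorph0 add0r.
rewrite mulr0 subr0 T1 //.
have := sum_chi K1; rewrite sum_coord (bigD1 0) //=.
rewrite (eq_bigr (fun t => chi (beta * i t))) => [|t _];
  last by rewrite rmorph0 add0r.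
rewrite T0 (eq_bigr (fun=> \sum_t chi (1 + beta * i t))) => [|t /T1 //].
have F1 : #|F|%:Z - 1 != 0 by rewrite subr_eq0 -[1]/(1%:Z) eqz_nat gtn_eqF
  ?card_finNzRing_gt1.
rewrite sum_nonzero_const -opprB -{1}[#|F|%:Z - 1]mulr1 addrC -mulrBr => /eqP.
by rewrite mulf_eq0 (negPf F1) /= subr_eq0 => /eqP.
Qed.

Lemma has_turyn_family_extension : has_turyn_family (#|K| ^ 2).
Proof.
have [f fK Kf] := coord_bij.
(* Total 1 makes the eigenvalue equations hold at infinity, and lets the entry there cancel the
   error term at finite points. *)
have [gam gam2 sum_gam] : exists2 e : F -> int,
    forall x, e x ^+ 2 = 1 & \sum_x e x = 1.
  have [e e2 se] := @balanced_signs F [set: F] (eq_ind_r odd oF (cardsT F)).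
  by exists e; rewrite // -se; apply: eq_bigl => x; rewrite inE.
(* Eigenvectors of the conference matrix [chi (det (rep m) (rep n))]. *)
pose g m := if m is Some y then gam (f y).2 else 1.
pose g' m := if m is Some y then gam (f y).1 else -1.
have g2 m : g m ^+ 2 = 1 by case: m => [y|]; rewrite /g ?gam2.
have g'2 m : g' m ^+ 2 = 1 by case: m => [y|]; rewrite /g' ?gam2 ?sqrrN.
have fE s t : f (i s + beta * i t) = (s, t) by apply: fK (s, t).
have detS (y y' : K) : det (rep (Some y)) (rep (Some y')) = y' - y.
  by rewrite /det /=; ring.
have detSN (y : K) : det (rep (Some y)) (rep None) = 1 by rewrite /det /=; ring.
have detNS (y : K) : det (rep None) (rep (Some y)) = -1 by rewrite /det /=; ring.
pose q := #|F|%:Z.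
have row s0 t0 t :
    \sum_s chi (coord (s0, t0) - coord (s, t)) = q * (t == t0)%:R - 1.
  rewrite (reindex_inj (inv_inj (subKr s0))) /= eq_sym -subr_eq0 -sum_chi_row.
  by apply: eq_bigr => s _; rewrite /coord /= !rmorphB; congr chi; ring.
have col s0 t0 s :
    \sum_t chi (coord (s0, t0) - coord (s, t)) = 1 - q * (s == s0)%:R.
  rewrite (reindex_inj (inv_inj (subKr t0))) /= eq_sym -subr_eq0 -sum_chi_col.
  by apply: eq_bigr => t _; rewrite /coord /= !rmorphB; congr chi; ring.
have pick1 (h : F -> int) x0 : \sum_x h x * (x == x0)%:R = h x0.
  rewrite (bigD1 x0) //= eqxx mulr1 big1 ?addr0 // => x /negPf->.
  by rewrite mulr0.
have Sg n : \sum_m g m * chi (det (rep m) (rep n)) = q * g n.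
  rewrite sum_option sum_coord exchange_big /=; case: n => [y|].
    rewrite detNS chiN // chi1 -[y]Kf; case: (f y) => s0 t0; rewrite /g fK /=.
    transitivity (1 + \sum_t (q * (gam t * (t == t0)%:R) - gam t)).
      congr (_ + _); apply: eq_bigr => t _.
      rewrite -[RHS](_ : gam t * (q * (t == t0)%:R - 1) = _); last by ring.
      rewrite -(row s0) mulr_sumr; apply: eq_bigr => s _.
      by rewrite fE /= detS.
    by rewrite sumrB -mulr_sumr pick1 sum_gam; ring.
  rewrite detvv chi0 mulr0 add0r mulr1.
  transitivity (\sum_t q * gam t); last by rewrite -mulr_sumr sum_gam mulr1.
  apply: eq_bigr => t _; rewrite -[q]sum1_finType mulr_suml; apply: eq_bigr => s _.
  by rewrite fE detSN chi1 mulr1 mul1r.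
have Sg' n : \sum_m g' m * chi (det (rep m) (rep n)) = - q * g' n.
  rewrite sum_option sum_coord /=; case: n => [y|].
    rewrite detNS chiN // chi1 -[y]Kf; case: (f y) => s0 t0; rewrite /g' fK /=.
    transitivity (-1 + \sum_s (gam s - q * (gam s * (s == s0)%:R))).
      congr (_ + _).
      apply: eq_bigr => s _.
      rewrite -[RHS](_ : gam s * (1 - q * (s == s0)%:R) = _); last by ring.
      rewrite -(col s0 t0) mulr_sumr; apply: eq_bigr => t _.
      by rewrite fE /= detS.
    by rewrite sumrB -mulr_sumr pick1 sum_gam; ring.
  rewrite detvv chi0 mulr0 add0r mulrN1 opprK.
  transitivity (\sum_s q * gam s); last by rewrite -mulr_sumr sum_gam mulr1.
  apply: eq_bigr => s _; rewrite -[q]sum1_finType mulr_suml; apply: eq_bigr => t _.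
  by rewrite fE detSN chi1 mulr1 mul1r.
pose gA := hsum g g'; pose gB := hdiff g g'.
have gE : g =1 gA \+ gB := hsumDhdiff _ _.
have g'E : g' =1 gA \- gB := hsumBhdiff g2 g'2.
have gAB m : gA m ^+ 2 = 1 /\ gB m = 0 \/ gA m = 0 /\ gB m ^+ 2 = 1.
  by rewrite /gA /gB /hsum /hdiff; case: eqP; rewrite g2; [left | right].
(* The entry -1 at infinity cancels the square of the sum of [gam]. Orthogonality makes the supports
   of [gA] and [gB] equally large. *)
have sgg' : \sum_m g m * g' m = 0.
  rewrite sum_option sum_coord /=.
  under eq_bigr do under eq_bigr do rewrite fE mulrC /=.
  by rewrite sum_mul2 sum_gam.
have SAB n : \sum_m gA m * chi (det (rep m) (rep n)) = q * gB n
         /\ \sum_m gB m * chi (det (rep m) (rep n)) = q * gA n.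
  have := Sg n; have := Sg' n.
  under eq_bigr do rewrite g'E mulrBl; rewrite sumrB.
  under [in X in _ -> X]eq_bigr do rewrite gE mulrDl; rewrite big_split /=.
  have solve2 (a b c d : int) : b - a = - q * (c - d) -> b + a = q * (c + d) ->
      b = q * d /\ a = q * c.
    rewrite mulrBr mulrDr !mulNr opprK; move: (q * c) (q * d) => x y; lia.
  by rewrite gE g'E /=; apply: solve2.
have cAB : 2 * \sum_m gA m ^+ 2 = #|K|%:Z + 1 /\ 2 * \sum_m gB m ^+ 2 = #|K|%:Z + 1.
  have s1 : \sum_m (gA m ^+ 2 + gB m ^+ 2) = #|K|%:Z + 1.
    rewrite (eq_bigr (fun=> 1)) ?sum1_finType ?card_option // => [|m _].
      by rewrite -addn1 PoszD.
    by case: (gAB m) => -[hA hB]; rewrite hA hB expr0n.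
  have : \sum_m (gA m ^+ 2 - gB m ^+ 2) = 0.
    transitivity (\sum_m g m * g' m); last exact: sgg'.
    by apply: eq_bigr => m _; rewrite gE g'E /=; ring.
  move: s1; rewrite big_split sumrB /=.
  by move: (bigop.body _ _ _) (bigop.body _ _ _) (#|K|%:Z) => a b k; lia.
pose A := [set m | g m == g' m].
have gA2 m : gA m ^+ 2 = (m \in A)%:R.
  by rewrite inE /gA /hsum; case: eqP; rewrite ?g2.
have gB2 m : gB m ^+ 2 = (m \in ~: A)%:R.
  by rewrite !inE /gB /hdiff; case: eqP; rewrite ?g2.
have sum_in (B : {set option K}) (e : option K -> int) :
    \sum_m e m * (m \in B)%:R = \sum_(m in B) e m.
  rewrite [RHS]big_mkcond; apply: eq_bigr => m _.
  by case: (m \in B); rewrite ?mulr1 ?mulr0.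
(* As [#|K| = 1] modulo 4, each support has odd size [(#|K| + 1) / 2], as [balanced_signs]
   requires. *)
have odd_card (B : {set option K}) : 2 * \sum_m (m \in B)%:R = #|K|%:Z + 1 ->
  odd #|B|.
  under eq_bigr do rewrite -[_%:R]mul1r.
  rewrite sum_in sumr_const (natz #|B|).
  by move: #|K| K1 #|B| => k k1 c; lia.
have [cA cB] := cAB.
have oA : odd #|A| by apply: odd_card; rewrite -cA;
  under [in RHS]eq_bigr do rewrite gA2.
have oB : odd #|~: A| by apply: odd_card; rewrite -cB;
  under [in RHS]eq_bigr do rewrite gB2.
have [e e2 se] := balanced_signs oA; have [e' e'2 se'] := balanced_signs oB.
apply: (@turyn_family_plane K q gA gB (fun m => if m \in A then e m else e' m))
  => //.
- by rewrite cK -[in LHS]natz natrX natz.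
- by move=> n; case: (SAB n).
- by move=> n; case: (SAB n).
- by move=> m; case: ifP.
- under eq_bigr do rewrite gA2; rewrite sum_in -se.
  by apply: eq_bigr => m ->.
under eq_bigr do rewrite gB2; rewrite sum_in -se'.
by apply: eq_bigr => m; rewrite inE => /negPf->.
Qed.

End QuadraticExtension.

Lemma has_turyn_family_prime p : prime p -> odd p -> has_turyn_family (p ^ 4).
Proof.
move=> p_pr op; have [K pK cK] := @pPrimePowerField p 2 p_pr isT.
(* [pPrimeCharType] makes the field an algebra over ['F_p], so that [in_alg] embeds the prime
   field. *)
pose L : finFieldType := pPrimeCharType pK.
have cL : #|L| = (#|'F_p| ^ 2)%N by rewrite card_Fp.
have oF : odd #|'F_p| by rewrite card_Fp.
have [b cb] := @chi_nonresidue L (etrans (congr1 (modn^~ 4) cL) (odd_sqr_mod4 oF)).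
have := @has_turyn_family_extension 'F_p L (in_alg L) oF cL b cb.
by rewrite cL card_Fp // -expnM.
Qed.

Lemma has_turyn_family_pow4 n : odd n -> (1 < n)%N -> has_turyn_family (n ^ 4).
Proof.
elim/ltn_ind: n => n IHn on n1.
have p_pr := pdiv_prime n1; have pn := pdiv_dvd n.
have op : odd (pdiv n) by apply: dvdn_odd pn on.
have hp := has_turyn_family_prime p_pr op.
rewrite -(divnK pn) expnMn.
have [n_p|n_p] := leqP (n %/ pdiv n) 1.
  have -> : (n %/ pdiv n = 1)%N.
    by apply/eqP; rewrite eqn_leq n_p divn_gt0 ?pdiv_gt0 // pdiv_leq // ltnW.
  by rewrite mul1n.
apply: turyn_family_prod => //; apply: IHn => //.
  by rewrite ltn_Pdiv ?pdiv_gt1 ?prime_gt1 // ltnW.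
by apply: dvdn_odd on; exact: dvdn_div.
Qed.

(** * Frobenius in the group ring *)

(** The inner binomial coefficients are multiples of [p]. Only the terms need to commute, as the
    lemma is applied in a matrix ring. *)
Lemma exprp_sum (A : pzRingType) (p : nat) (I : Type) (r : seq I) (P :
  pred I) (F : I -> A) :
  prime p -> (forall a : A, a *+ p = 0) ->
  (forall i j, GRing.comm (F i) (F j)) ->
  (\sum_(i <- r | P i) F i) ^+ p = \sum_(i <- r | P i) F i ^+ p.
Proof.
move=> p_pr Ap cF; elim: r => [|i r IHr].
  by rewrite !big_nil expr0n -(prednK (prime_gt0 p_pr)).
rewrite !big_cons; case: (P i) => //.
rewrite exprDn_comm; last by apply: commr_sum => j _; apply: cF.
case: p p_pr Ap IHr => // p p_pr Ap IHr.
rewrite big_ord_recl big_ord_recr /= subn0 subnn !expr0 mulr1 mul1r bin0 binn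
  !mulr1n.
rewrite IHr big1 ?add0r // => j _.
have /dvdnP[k ->] := prime_dvd_bin p_pr (k := bump 0 j) (ltn_ord (lift ord0 j)).
by rewrite mulrnA Ap.
Qed.

Lemma intr_Fp_eq0 p (a : int) : prime p ->
  (a%:~R == 0 :> 'F_p) = (p %| `|a|)%N.
Proof.
move=> p_pr; rewrite (dvdn_pcharf (pchar_Fp p_pr)).
by case: a => n; rewrite // NegzE rmorphN oppr_eq0 abszN.
Qed.

Section GroupRing.
Variables (gT : finGroupType) (G : {group gT}) (p : nat).
Hypotheses (abG : abelian G) (p_pr : prime p).
Implicit Types (f g : gT -> int) (x y z : gT).

Local Notation aG := (regular_repr 'F_p G).

(** The element of the group ring over [F_p] with coefficients [f], as a matrix of the regular
    representation. *)
Definition grmx f : 'M['F_p]_(gcard G) := \sum_(x in G) (f x)%:~R *: aG x.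

Lemma grmxM f g : grmx f *m grmx g = grmx (gconv G f g).
Proof.
rewrite /grmx mulmx_suml.
transitivity (\sum_(x in G) \sum_(z in G) (f x * g (x^-1 * z)%g)%:~R *: aG z).
  apply: eq_bigr => x Gx; rewrite mulmx_sumr.
  rewrite [RHS](reindex_inj (mulgI x)) /=; apply: eq_big => [y|y Gy].
    by rewrite groupMl.
  by rewrite mulKg repr_mxM // -scalemxAl -scalemxAr scalerA -intrM.
rewrite exchange_big /=; apply: eq_bigr => z Gz.
by rewrite -scaler_suml -rmorph_sum.
Qed.

Lemma eq_grmx f g : {in G, f =1 g} -> grmx f = grmx g.
Proof. by move=> fg; apply: eq_bigr => x Gx; rewrite fg. Qed.

Lemma grmxZ (a : int) f : grmx (fun x => a * f x) = a%:~R *: grmx f.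
Proof.
by rewrite scaler_sumr; apply: eq_bigr => x _; rewrite intrM scalerA.
Qed.

Lemma gring_proj_sum (f : gT -> int) (h : gT -> gT) z :
  {in G, forall x, h x \in G} -> {in G &, injective h} -> z \in G ->
  gring_proj (h z) (\sum_(x in G) (f x)%:~R *: aG (h x)) = (f z)%:~R *: 1.
Proof.
move=> hG h_inj Gz; rewrite linear_sum /= (bigD1 z) //= linearZ /= gring_projE
  ?hG //.
rewrite eqxx big1 ?addr0 // => x /andP[Gx xz].
by rewrite linearZ /= gring_projE ?hG // (inj_in_eq h_inj) // eq_sym (negPf xz)
  scaler0.
Qed.

Lemma grmx_Frobenius f :
  grmx f ^+ p = \sum_(x in G) (f x)%:~R *: aG (x ^+ p)%g.
Proof.
have aGX x n : x \in G -> (aG x : 'M_(gcard G)) ^+ n = aG (x ^+ n)%g.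
  move=> Gx; elim: n => [|n IHn]; first by rewrite expr0 expg0 repr_mx1.
  by rewrite exprS IHn expgS repr_mxM ?groupX.
have ZX (a : 'F_p) (M : 'M['F_p]_(gcard G)) n : (a *: M) ^+ n = a ^+ n *: M ^+ n.
  elim: n => [|n IHn]; first by rewrite !expr0 scale1r.
  by rewrite !exprS IHn -!mulmxE -scalemxAl -scalemxAr scalerA.
rewrite /grmx big_mkcond /= exprp_sum //.
- rewrite [RHS]big_mkcond; apply: eq_bigr => x _; case: ifP => [Gx|_].
    by rewrite ZX aGX // -{2}(expf_card ((f x)%:~R : 'F_p)) card_Fp.
  by rewrite expr0n -(prednK (prime_gt0 p_pr)).
- by move=> M; rewrite -scaler_nat pchar_Fp_0 // scale0r.
move=> x y; case: ifP => Gx; last by rewrite /GRing.comm mul0r mulr0.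
case: ifP => Gy; last by rewrite /GRing.comm mul0r mulr0.
rewrite /GRing.comm -!mulmxE -!scalemxAl -!scalemxAr !scalerA mulrC.
by rewrite -!repr_mxM // (centsP abG).
Qed.

Hypothesis co_p : coprime #|G| p.

Lemma expg_inj_in : {in G &, injective (fun x => x ^+ p)%g}.
Proof. exact: can_in_inj (expgK co_p). Qed.

Lemma grmx_coef_expp f z : z \in G ->
  gring_proj (z ^+ p)%g (grmx f ^+ p) = (f z)%:~R *: 1.
Proof.
move=> Gz; rewrite grmx_Frobenius (@gring_proj_sum f (fun x => x ^+ p)%g) //.
  by move=> x Gx; rewrite groupX.
exact: expg_inj_in.
Qed.

(** Modulo [p] the square of the element is 0, hence so is its [p]-th power; by Frobenius the
    coefficients of that power are those of [f], moved by the injection [x -> x^p]. *)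
Lemma dvd_of_gconv_sqr f :
  (forall z, z \in G -> (p %| `|gconv G f f z|)%N) ->
  forall z, z \in G -> (p %| `|f z|)%N.
Proof.
move=> fp z Gz; have M2 : grmx f *m grmx f = 0.
  rewrite grmxM /grmx big1 // => x Gx.
  by have := fp x Gx; rewrite -intr_Fp_eq0 // => /eqP ->; rewrite scale0r.
have := grmx_coef_expp f Gz.
have -> : grmx f ^+ p = 0.
  have pE : (p = p.-2.+2)%N by move: p_pr; case: (p) => [|[]].
  by rewrite [X in _ ^+ X]pE 2!exprS mulrA -mulmxE M2 mulmxE mul0r.
rewrite linear0.
move=> /(congr1 (fun M : 'M_1 => M 0 0)); rewrite !mxE mulr1 => /esym/eqP.
by rewrite intr_Fp_eq0.
Qed.

(** From [f * f * f = m^2 f] the [p]-th power of [f] is [m^(p-1) f], which is [f] modulo [p].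
    Comparison with Frobenius at [z^p] gives a congruence modulo [p], and the two values differ by
    at most 2. *)
Lemma multiplier_prime f m : odd p -> (#|G| = m ^ 2)%N ->
  (forall z, z \in G -> (`|f z| <= 1)%N) ->
  (forall z, z \in G -> gconv G (gconv G f f) f z = #|G|%:Z * f z) ->
  forall z, z \in G -> f (z ^+ p)%g = f z.
Proof.
move=> op Gm f1 f3 z Gz.
have M3 : grmx f ^+ 3 = (#|G|%:R : 'F_p) *: grmx f.
  by rewrite 2!exprSr expr1 -!mulmxE !grmxM (eq_grmx f3) grmxZ.
have MX k : grmx f ^+ (k.*2.+1) = (#|G|%:R ^+ k : 'F_p) *: grmx f.
  elim: k => [|k IHk]; first by rewrite expr0 scale1r expr1.
  rewrite doubleS 2!exprS IHk mulrA -expr2 -!mulmxE -scalemxAr !mulmxE -exprSr M3.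
  by rewrite scalerA -exprSr.
have Mp : grmx f ^+ p = grmx f.
  have pE : p = p./2.*2.+1 by rewrite -[LHS]odd_double_half op.
  have m0 : (m%:R : 'F_p) != 0.
    rewrite -(dvdn_pcharf (pchar_Fp p_pr)) -prime_coprime //.
    by rewrite coprime_sym -(coprime_pexpl _ _ (isT : 0 < 2)%N) -Gm.
  rewrite [X in _ ^+ X]pE MX Gm natrX -exprM mul2n.
  have -> : (m%:R : 'F_p) ^+ p./2.*2 = 1; last by rewrite scale1r.
  apply: (mulfI m0); rewrite mulr1 -exprS -pE -[X in _ ^+ X](card_Fp p_pr).
  exact: expf_card.
have := grmx_coef_expp f Gz; rewrite Mp.
have := @gring_proj_sum f id (z ^+ p)%g (fun x Gx => Gx) (fun x y _ _ e =>
  e) (groupX p Gz).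
rewrite -/(grmx f) /= => -> /(congr1 (fun M : 'M_1 => M 0 0)); rewrite !mxE !mulr1.
move/eqP; rewrite -subr_eq0 -intrB intr_Fp_eq0 //.
have := f1 _ Gz; have := f1 _ (groupX p Gz).
move: (f _) (f _) => b a b1 a1 pab; have p3 := odd_prime_gt2 op p_pr.
have ab2 : (`|a - b| < p)%N by lia.
have : (`|a - b| == 0)%N.
  by apply: contraLR pab; rewrite -lt0n => ab0; rewrite gtnNdvd.
by rewrite absz_eq0 subr_eq0 => /eqP.
Qed.

End GroupRing.

(** * Necessity *)

(** Induction from [(2 r + 1)^2 = 1 + 4 r (r + 1)]. It is applied to [p = 2 r + 1], where
    [4 r = 2 (p - 1)]. *)
Lemma pow_sqr_mod (r : int) n :
  exists c : int, (2 * r + 1) ^+ n.*2 = 1 + 4 * r * c.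
Proof.
elim: n => [|n [c IH]]; first by exists 0; rewrite mulr0 addr0.
exists (c * (2 * r + 1) ^+ 2 + (r + 1)); rewrite doubleS 2!exprS IH; ring.
Qed.

(** Equal signs would make [4 r] divide [2 r]; opposite signs make it divide [2 r + 2], so [r]
    divides 1. *)
Lemma congr_pm1_eq3 (r d e w : int) : 0 < r -> d ^+ 2 = 1 -> e ^+ 2 = 1 ->
  d * (2 * r + 1) - e = 4 * r * w -> r = 1.
Proof.
have solve (x : int) : r * x = 0 -> 0 < r -> x = 0.
  by move=> /eqP; rewrite mulf_eq0 => /orP[]/eqP // -> ; rewrite ltxx.
have r_eq1 (x : int) : 0 < r -> r * x = 1 -> r = 1.
  move=> r0 rx; have x0 : 0 < x by rewrite -(pmulr_rgt0 _ r0) rx.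
  have : r <= r * x by apply: ler_peMr; [exact: ltW | rewrite -gtz0_ge1].
  by rewrite rx; lia.
move=> r0 /sqr1_int[]-> /sqr1_int[]-> eq_w.
- suff /solve/(_ r0) : r * (1 - 2 * w) = 0 by lia.
  by apply: (mulfI (isT : 2 != 0 :> int)); rewrite mulr0 -(subrr (4 * r * w))
    -{1}eq_w; ring.
- apply: (r_eq1 (2 * w - 1)) => //.
  apply: (mulfI (isT : 2 != 0 :> int)).
  by transitivity (4 * r * w - 2 * r); [ring | rewrite -eq_w; ring].
- apply: (r_eq1 (- (2 * w) - 1)) => //.
  apply: (mulfI (isT : 2 != 0 :> int)).
  by transitivity (- (4 * r * w) - 2 * r); [ring | rewrite -eq_w; ring].
suff /solve/(_ r0) : r * (1 + 2 * w) = 0 by lia.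
apply: (mulfI (isT : 2 != 0 :> int)).
by transitivity (2 * r + 4 * r * w); [ring | rewrite -eq_w; ring].
Qed.

(** Modulo [2 (p - 1)] even powers of [p] are 1 and odd ones are [p], so the equation becomes a
    congruence between [p] and 1 up to signs. *)
Lemma odd_power_congr (p s : nat) (u e k : int) : odd p -> (1 < p)%N -> odd s ->
  u = (p ^ s)%:Z \/ u = - (p ^ s)%:Z -> e ^+ 2 = 1 ->
  u = e + 2 * (p%:Z - 1) * k - ((p ^ s.*2)%:Z - 1) -> p = 3%N.
Proof.
move=> op p1 os uE e2; pose r := p./2%:Z.
have pE : p%:Z = 2 * r + 1 by rewrite /r; lia.
have powE n : (p ^ n)%:Z = (2 * r + 1) ^+ n by rewrite -pE -(natz (p ^ n))
  natrX natz.
have [c cE] := pow_sqr_mod r s; have [c' c'E] := pow_sqr_mod r s./2.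
have [d d2 uE'] : exists2 d : int, d ^+ 2 = 1 & u = d * (2 * r + 1) ^+ s.
  by case: uE => ->; [exists 1 | exists (-1)]; rewrite // powE ?mul1r ?mulN1r.
rewrite uE' powE cE pE -[s in _ ^+ s]odd_double_half os add1n exprS c'E => h.
have r1 : r = 1; last by rewrite /r in r1; lia.
apply: (@congr_pm1_eq3 r d e (k - c - d * (2 * r + 1) * c')) => //.
  by rewrite /r; lia.
transitivity (d * ((2 * r + 1) * (1 + 4 * r * c')) - d * (2 * r + 1) * (4 * r *
  c') - e).
  by ring.
by rewrite h; ring.
Qed.

Lemma big_dprod_pair (gT : finGroupType) (G P Q : {group gT}) (f : gT -> int) :
  (P \x Q)%g = G ->
  \sum_(g in G) f g = \sum_(y in Q) \sum_(x in P) f (x * y)%g.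
Proof.
move=> defG; have [_ PQ _ tiPQ] := dprodP defG.
rewrite exchange_big pair_big /=.
rewrite (reindex_onto (fun u : gT * gT => u.1 * u.2)%g
  (fun g => (divgr P Q g, remgr P Q g))) /= => [|g _]; last by rewrite -divgr_eq.
apply: eq_bigl => -[x y] /=; apply/andP/andP => [[Gxy /eqP[xE yE]]|[Px Qy]].
  rewrite -PQ in Gxy; split; first by rewrite -xE mem_divgr.
  by rewrite -yE mem_remgr.
by rewrite -PQ mem_mulg // divgrMid // remgrMid.
Qed.

(* Descent on the exponent: by Frobenius [F] vanishes mod [p], so it can be
  divided by [p]. *)
Lemma gconv_pow_descent (gT : finGroupType) (Q : {group gT}) p a (F : gT -> int) :
  abelian Q -> prime p -> coprime #|Q| p -> Q :!=: 1%g ->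
  (forall z, z \in Q -> gconv Q F F z = (p ^ a)%:Z * (#|Q|%:Z * (z == 1%g)%:R -
    1)) ->
  exists s (h : gT -> int), [/\ a = s.*2,
    forall z, z \in Q -> F z = (p ^ s)%:Z * h z &
    forall z, z \in Q -> gconv Q h h z = #|Q|%:Z * (z == 1%g)%:R - 1].
Proof.
move=> abQ p_pr co_p ntQ; have [a'] := ubnP a; elim: a' a F => // a' IH a F lea cF.
have p0 : (p%:Z : int) != 0 by rewrite eqz_nat -lt0n prime_gt0.
case: a => [|a] in lea cF *.
  exists 0, F; split=> // z Qz; first by rewrite expn0 mul1r.
  by rewrite cF // expn0 mul1r.
have Fp z : z \in Q -> (p %| `|F z|)%N.
  apply: (dvd_of_gconv_sqr abQ p_pr co_p) => {}z Qz.
  by rewrite cF // abszM expnS dvdn_mulr // absz_nat dvdn_mulr.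
pose h z := (F z %/ p%:Z)%Z.
have Fh z : z \in Q -> F z = p%:Z * h z.
  by move=> /Fp pF; rewrite mulrC divzK // dvdzE.
have ch z : z \in Q -> gconv Q F F z = p%:Z * (p%:Z * gconv Q h h z).
  move=> Qz; rewrite !mulr_sumr; apply: eq_bigr => x Qx.
  by rewrite !Fh ?groupM ?groupV //; ring.
(* Exponent 1 is impossible: at some [z != 1] it would make [p] divide -1. *)
case: a => [|a] in lea cF *.
  have [z Qz z1] := trivgPn _ ntQ.
  have := ch z Qz; rewrite cF // (negPf z1) mulr0 sub0r expn1 => /(mulfI p0) pc.
  have : (p %| 1)%N.
    rewrite -[1%N]/(`|-1%:Z|%N) pc abszM absz_nat dvdn_mulr //.
  by rewrite dvdn1 => /eqP p1; rewrite p1 in p_pr.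
have {}ch z : z \in Q -> gconv Q h h z = (p ^ a)%:Z * (#|Q|%:Z * (z == 1%g)%:R - 1).
  move=> Qz; apply: (mulfI p0); apply: (mulfI p0); rewrite -ch // cF //.
  by rewrite !expnS !PoszM !mulrA.
have a_lt : (a < a')%N by rewrite ltnS in lea; apply: ltnW.
have [s [h' [aE hE ch']]] := IH a h a_lt ch.
exists s.+1, h'; split=> //; first by rewrite aE doubleS.
by move=> z Qz; rewrite Fh // hE // expnS PoszM mulrA.
Qed.

(** [N] is a disjoint union of sets of generators of nontrivial cyclic [p]-groups, each of size
    [p^(k-1) (p-1)] for some [k > 0]. *)
Lemma dvdn_card_generator_closed (gT : finGroupType) (P : {group gT}) (N :
  {set gT}) p :
  prime p -> (p.-group P)%g -> N \subset P -> 1%g \notin N ->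
  (forall x y, x \in N -> <[x]>%g = <[y]>%g -> y \in N) ->
  (p.-1 %| #|N|)%N.
Proof.
move=> p_pr pP sNP N1 Ngen.
rewrite -sum1_card (partition_big (fun x => <[x]>%g) predT) //=.
apply: dvdn_sum => C _.
have [x /andP[Nx /eqP CE]|N0] := pickP (fun x => (x \in N) && (<[x]>%g == C));
  last first.
  by rewrite big_pred0.
rewrite sum1_card (_ : #|_| = totient #[x]%g); last first.
  rewrite totient_gen; apply: eq_card => y; rewrite !inE /generator -CE eq_sym.
  rewrite -topredE /=; case: eqP => [/esym e|_]; last by rewrite andbF.
  by rewrite (Ngen x y Nx e).
have x1 : x != 1%g by apply: contraNneq N1 => <-.
have [k /= oxk] := p_natP (mem_p_elt pP (subsetP sNP x Nx)).
have k0 : (0 < k)%N.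
  by rewrite lt0n; apply: contraNneq x1 => k0; rewrite -order_eq1 oxk k0.
by rewrite oxk totient_pfactor // dvdn_mulr.
Qed.

Lemma cycle_eq_coprime (gT : finGroupType) (x y : gT) : <[x]>%g = <[y]>%g ->
  exists2 k, y = (x ^+ k)%g & coprime #[x]%g k.
Proof.
move=> xy; have /cycleP[k yE] : y \in <[x]>%g by rewrite xy cycle_id.
exists k => //; have := generator_coprime x k.
by rewrite /generator -yE xy eqxx => <-.
Qed.

Lemma double_neq_odd (n k : nat) : odd n -> 2 * k%:Z - n%:Z <> 0.
Proof. by lia. Qed.

Lemma int_sqr_ge1 (c : int) : c != 0 -> 1 <= c ^+ 2.
Proof. by nia. Qed.

Section Necessity.
Variables (gT : finGroupType) (G : {group gT}) (f : gT -> int).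
Hypotheses (abG : abelian G) (oG : odd #|G|).
Hypothesis f1 : f 1%g = 0.
Hypothesis f2 : forall x, x != 1%g -> f x ^+ 2 = 1.
Hypothesis fV : forall x, f x^-1%g = f x.
Hypothesis cf : forall z, z \in G -> gconv G f f z = #|G|%:Z * (z == 1%g)%:R - 1.

Lemma gconv3 z : z \in G -> gconv G (gconv G f f) f z = #|G|%:Z * f z.
Proof.
move=> Gz; transitivity (\sum_(x in G) (#|G|%:Z * ((x == 1%g)%:R * f (x^-1 *
  z)%g) - f (x^-1 * z)%g)).
  by apply: eq_bigr => x Gx; rewrite cf //; ring.
rewrite sumrB -mulr_sumr sum_delta ?group1 // invg1 mul1g.
rewrite -[RHS]subr0; congr (_ - _); rewrite -[RHS](gconv_sum_eq0 cf).
rewrite [RHS](reindex_inj (inj_comp (mulIg z) invg_inj)) /=.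
by apply: eq_bigl => x; rewrite groupMr ?groupV.
Qed.

Lemma absf z : (`|f z| <= 1)%N.
Proof.
have [->|/f2] := eqVneq z 1%g; first by rewrite f1.
by case/sqr1_int => ->.
Qed.

(** Split [t] into primes, all odd and prime to [#|G|], and apply [multiplier_prime] to each. *)
Lemma multiplier m t : (#|G| = m ^ 2)%N -> odd t -> coprime #|G| t ->
  forall z, z \in G -> f (z ^+ t)%g = f z.
Proof.
move=> Gm; elim/ltn_ind: t => t IH ot cot z Gz.
have [t1|t1] := leqP t 1.
  by have -> : t = 1%N by case: t t1 ot {IH cot} => [|[]].
have q_pr := pdiv_prime t1; have qt := pdiv_dvd t.
have oq := dvdn_odd qt ot; have coq := coprime_dvdr qt cot.
rewrite -(divnK qt) expgM.
rewrite (multiplier_prime abG q_pr coq oq Gm) ?groupX //.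
- apply: IH => //; first by rewrite ltn_Pdiv ?prime_gt1 // ltnW.
    exact: dvdn_odd (dvdn_div qt) ot.
  exact: coprime_dvdr (dvdn_div qt) cot.
- by move=> x _; apply: absf.
exact: gconv3.
Qed.

Variables (P Q : {group gT}) (p a : nat).
Hypotheses (p_pr : prime p) (cP : (#|P| = p ^ a)%N) (coQ : coprime #|Q| p).
Hypotheses (defG : (P \x Q)%g = G) (ntQ : Q :!=: 1%g) (a_gt0 : (0 < a)%N).

Let F (y : gT) : int := \sum_(x in P) f (x * y)%g.

Let sPG : P \subset G. Proof. by case/dprodP: defG => _ <- _ _;
  apply: mulG_subl. Qed.
Let sQG : Q \subset G. Proof. by case/dprodP: defG => _ <- _ _;
  apply: mulG_subr. Qed.

Let commPQ x y : x \in G -> y \in G -> (x * y = y * x)%g.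
Proof. by move=> Gx Gy; apply: (centsP abG). Qed.

Let mulPQ_eq1 x y : x \in P -> y \in Q -> (x * y == 1)%g = (x == 1%g) && (y == 1%g).
Proof.
move=> Px Qy; apply/eqP/andP => [xy|[/eqP-> /eqP->]]; last by rewrite mulg1.
have [_ _ _ tiPQ] := dprodP defG.
have x1 : x = 1%g.
  apply/set1gP; rewrite -tiPQ inE Px /= (_ : x = y^-1)%g ?groupV //.
  by apply/eqP; rewrite eq_mulgV1 invgK xy.
by rewrite x1 eqxx -[y]mul1g -{1}x1 xy.
Qed.

(** The value at [z] is the sum of [f * f] over the coset of [P] through [z]. *)
Lemma gconv_F z : z \in Q ->
  gconv Q F F z = (p ^ a)%:Z * (#|Q|%:Z * (z == 1%g)%:R - 1).
Proof.
move=> Qz; have GP x : x \in P -> x \in G by apply: subsetP.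
have GQ x : x \in Q -> x \in G by apply: subsetP.
have -> : gconv Q F F z = \sum_(w in P) gconv G f f (w * z)%g.
  rewrite /gconv.
  under [RHS]eq_bigr do rewrite (big_dprod_pair _ defG).
  rewrite exchange_big /=; apply: eq_bigr => y Qy.
  rewrite exchange_big /= /F mulr_suml; apply: eq_bigr => x Px.
  rewrite -mulr_sumr; congr (_ * _).
  rewrite (reindex_inj (mulgI x^-1)%g) /=.
  apply: eq_big => [w|w]; first by rewrite groupMl ?groupV.
  rewrite groupMl ?groupV // => Pw; congr f.
  have [Gx Gy Gw] : [/\ x \in G, y \in G & w \in G]
    by split; [apply: GP | apply: GQ | apply: GP].
  rewrite invMg (commPQ (groupVr Gy) (groupVr Gx)) -!mulgA; congr (_ * _)%g.
  by rewrite !mulgA (commPQ Gw (groupVr Gy)).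
rewrite (eq_bigr (fun w => #|G|%:Z * ((w == 1%g)%:R * (z == 1%g)%:R) - 1)) =>
  [|w Pw].
  rewrite sumrB sumr_const -mulr_sumr (sum_delta (G := P) (fun=> _)) ?group1 //.
  by rewrite (natz #|P|) -(dprod_card defG) cP PoszM; ring.
rewrite cf; last by apply: groupM; [apply: GP | apply: GQ].
by rewrite mulPQ_eq1 //; case: (w == 1%g); case: (z == 1%g).
Qed.

Let xy_neq1 x y : x \in P -> y \in Q -> y != 1%g -> (x * y)%g != 1%g.
Proof. by move=> Px Qy /negPf y1; rewrite mulPQ_eq1 // y1 andbF. Qed.

Lemma F_card y : y \in Q -> y != 1%g ->
  F y = 2 * #|[set x in P | f (x * y)%g == 1]|%:Z - #|P|%:Z.
Proof.
move=> Qy y1; set N := [set _ in P | _].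
have sNP : N \subset P by apply/subsetP=> x; rewrite inE => /andP[].
rewrite -(natz #|P|) -(sum_mem sNP) -sumr_const.
rewrite mulr_sumr -sumrB; apply: eq_bigr => x Px; rewrite inE Px /=.
by case/sqr1_int: (f2 (xy_neq1 Px Qy y1)) => ->.
Qed.

Lemma F_inv y : y \in Q -> F y^-1%g = F y.
Proof.
move=> Qy; rewrite /F (reindex_inj invg_inj) /=.
apply: eq_big => [x|x]; rewrite groupV // => Px.
rewrite -invMg fV (commPQ (subsetP sQG y Qy)) //; exact: subsetP sPG x Px.
Qed.

(** Off 1, [F] is odd by [F_card], so [h] is nonzero there. By symmetry the squares of [h] sum to
    [(h * h) 1 = #|Q| - 1], which forces each of them to be 1 off the identity. *)
Lemma F_sqr : exists2 s, a = s.*2 &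
  forall y, y \in Q -> y != 1%g -> F y = (p ^ s)%:Z \/ F y = - (p ^ s)%:Z.
Proof.
have abQ : abelian Q by apply: abelianS abG.
have [s [h [aE Fh ch]]] := gconv_pow_descent abQ p_pr coQ ntQ gconv_F.
have ps0 : (p ^ s)%:Z != 0 :> int by rewrite eqz_nat -lt0n expn_gt0 prime_gt0.
exists s => // y Qy y1; rewrite Fh //.
have hV z : z \in Q -> h z^-1%g = h z.
  by move=> Qz; apply: (mulfI ps0); rewrite -!Fh ?groupV // F_inv.
have h0 z : z \in Q -> z != 1%g -> 0 <= h z ^+ 2 - 1.
  move=> Qz z1; have hz : h z != 0.
    apply/eqP=> hz; have := F_card Qz z1; rewrite Fh // hz mulr0.
    have : odd #|P| by apply: dvdn_odd oG; apply: cardSg.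
    by move=> oP /esym; apply: double_neq_odd.
  by rewrite subr_ge0 int_sqr_ge1.
have hsum : \sum_(z in Q) h z ^+ 2 = #|Q|%:Z - 1.
  have := ch _ (group1 Q); rewrite eqxx mulr1 => <-.
  by apply: eq_bigr => z Qz; rewrite mulg1 hV // expr2.
have hsum0 : h 1%g ^+ 2 + \sum_(z in Q | z != 1%g) (h z ^+ 2 - 1) = 0.
  have q1 : \sum_(z in Q) 1 = #|Q|%:Z by rewrite sumr_const (natz #|Q|).
  rewrite (bigD1 1%g) ?group1 //= in q1; rewrite (bigD1 1%g) ?group1 //= in hsum.
  by rewrite sumrB addrA hsum -q1 [1 + _ - 1]addrAC subrr add0r subrr.
have nn : 0 <= \sum_(z in Q | z != 1%g) (h z ^+ 2 - 1).
  by apply: sumr_ge0 => z /andP[Qz z1]; apply: h0.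
have /eqP : \sum_(z in Q | z != 1%g) (h z ^+ 2 - 1) = 0.
  by move/eqP: hsum0; rewrite paddr_eq0 ?sqr_ge0 // => /andP[_ /eqP].
rewrite psumr_eq0 => [/allP/(_ y)|z /andP[Qz z1]]; last exact: h0.
rewrite mem_index_enum Qy y1 /= => /(_ isT); rewrite subr_eq0 => /eqP.
by case/sqr1_int => ->; [left | right]; rewrite ?mulr1 ?mulrN1.
Qed.

(** By [F_card], [F y] counts the [x] in [P] with [f (x * y) = 1]. Those other than 1 are closed
    under change of generator, by a multiplier acting as wanted on [P] and trivially on [Q], so
    [p - 1] divides their number; [x = 1] contributes [f y]. *)
Lemma F_mod m : (#|G| = m ^ 2)%N -> forall y, y \in Q -> y != 1%g ->
  exists k : int, F y = f y + 2 * (p%:Z - 1) * k - ((p ^ a)%:Z - 1).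
Proof.
move=> Gm y Qy y1; pose N := [set x in P | f (x * y)%g == 1].
have Gy := subsetP sQG y Qy.
have pP : (p.-group P)%g by rewrite /pgroup cP pnatX pnat_id.
have coPQ : coprime #|P| #|Q| by rewrite cP coprimeXl // coprime_sym.
have /dvdnP[k Nk] : (p.-1 %| #|N :\ 1%g|)%N.
  apply: (dvdn_card_generator_closed p_pr pP); rewrite ?setD11 //.
    by apply/subsetP=> x; rewrite !inE => /and3P[].
  move=> x x'; rewrite !inE => /and3P[x1 Px fx] xx'.
  have [j x'E coj] := cycle_eq_coprime xx'.
  have Px' : x' \in P by rewrite x'E groupX.
  have x'1 : x' != 1%g by rewrite -cycle_eq1 -xx' cycle_eq1.
  rewrite x'1 Px' /=; apply/eqP; rewrite -(eqP fx).
  have pj : coprime #|P| j.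
    rewrite cP coprimeXl //; apply: coprime_dvdl coj.
    have [i /= oxi] := p_natP (mem_p_elt pP Px).
    rewrite oxi; case: i oxi => [|i] oxi; last by rewrite dvdn_exp.
    by rewrite -order_eq1 oxi expn0 in x1.
  (* An odd [t] with [(x * y) ^+ t = x ^+ j * y]. *)
  pose t0 := chinese #|P| #|Q| j 1; pose t := if odd t0 then t0 else (t0 + #|G|)%N.
  have cG : (#|G| = #|P| * #|Q|)%N by rewrite -(dprod_card defG).
  have tP : t = j %[mod #|P|].
    rewrite /t -(chinese_modl coPQ j 1) -/t0; case: ifP => // _.
    by rewrite cG mulnC addnC modnMDl.
  have tQ : t = 1 %[mod #|Q|].
    rewrite /t -(chinese_modr coPQ j 1) -/t0; case: ifP => // _.
    by rewrite cG addnC modnMDl.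
  have ot : odd t by rewrite /t; case: ifP => //; rewrite oddD oG => ->.
  have coGt : coprime #|G| t.
    rewrite cG coprimeMl -(coprime_modr #|P| t) -(coprime_modr #|Q| t) tP tQ.
    by rewrite !coprime_modr pj coprimen1.
  rewrite -[RHS](multiplier Gm ot coGt); last by rewrite groupM // (subsetP sPG).
  rewrite expgMn; last by apply: commPQ => //; exact: subsetP sPG x Px.
  have expg_mod_card (R : {group gT}) u n1 n2 : u \in R ->
      n1 = n2 %[mod #|R|] -> (u ^+ n1 = u ^+ n2)%g.
    move=> Ru n12; rewrite -(expg_mod n1 (expg_cardG Ru)) n12.
    by rewrite (expg_mod n2 (expg_cardG Ru)).
  by rewrite x'E (expg_mod_card P x t j) // (expg_mod_card Q y t 1%N).
exists k%:Z; rewrite F_card // (cardsD1 1%g) Nk cP.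
have -> : (1%g \in N) = (f y == 1) by rewrite inE group1 mul1g.
have p1 := prime_gt0 p_pr.
rewrite PoszD PoszM -subn1 -subzn //.
by case/sqr1_int: (f2 y1) => ->; rewrite /=; ring.
Qed.

Lemma even_exponent : exists2 s, a = s.*2 & forall m, (#|G| = m ^ 2)%N -> odd s
  -> p = 3%N.
Proof.
have [s aE Fs] := F_sqr; exists s => // m Gm os.
have [y Qy y1] := trivgPn _ ntQ.
have op : odd p.
  apply: (dvdn_odd _ oG); rewrite -(dprod_card defG) cP dvdn_mulr //.
  by case: a a_gt0 => // b _; rewrite expnS dvdn_mulr.
have [k Fk] := F_mod Gm Qy y1; rewrite aE in Fk.
exact: (odd_power_congr op (prime_gt1 p_pr) os (Fs y Qy y1) (f2 y1) Fk).
Qed.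

End Necessity.

(** * Exponents of the primes in the order *)

Lemma Paley_PDS_logn (gT : finGroupType) (G : {group gT}) (D : {set gT}) p :
  abelian G -> odd #|G| -> is_Paley_PDS G D -> ~ is_prime_power #|G| ->
  prime p -> (p %| #|G|)%N ->
  exists2 s, logn p #|G| = s.*2 & forall m, (#|G| = m ^ 2)%N -> odd s -> p = 3%N.
Proof.
move=> abG oG paleyD npp p_pr pG; have G1 : (#|G| = 1 %[mod 4])%N by case: paleyD.
have [sDG DV D1 cD] := (PaleyP D G1).1 paleyD.
have defG := nilpotent_pcoreC p (abelian_nil abG).
have nilG := abelian_nil abG.
have cP : #|'O_p(G)%g| = (p ^ logn p #|G|)%N.
  by rewrite (card_Hall (nilpotent_pcore_Hall p nilG)) p_part.
have coQ : coprime #|'O_p^'(G)%g| p.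
  rewrite coprime_sym prime_coprime // (card_Hall (nilpotent_pcore_Hall p^' nilG)).
  by rewrite -p'natE // part_pnat.
have a0 : (0 < logn p #|G|)%N by rewrite logn_gt0 mem_primes p_pr cardG_gt0.
(* A trivial complement would make the order a power of [p]. *)
have ntQ : 'O_p^'(G)%G :!=: 1%g.
  apply/eqP=> /= Q1; apply: npp; exists p, (logn p #|G|); split=> //.
  by rewrite -cP -{1}(dprod_card defG) Q1 cards1 muln1.
apply: (@even_exponent _ G (psign D) abG oG _ _ _ cD 'O_p(G)%G 'O_p^'(G)%G) => //.
- by rewrite psign_val // eqxx.
- by move=> x /negPf x1; rewrite psign_val // x1; case: ifP.
- by move=> x; rewrite !psign_val // invg_eq1 -mem_invg DV.
Qed.

Lemma exact_root_of_logn k n : (0 < n)%N ->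
  (forall p, prime p -> (p %| n)%N -> (k %| logn p n)%N) -> exists m, n = (m ^ k)%N.
Proof.
move=> n0 kn; exists (\prod_(p <- primes n) p ^ (logn p n %/ k))%N.
rewrite (big_morph (fun x => x ^ k)%N (fun x y => expnMn x y k) (exp1n k)).
rewrite {1}(prod_prime_decomp n0) prime_decompE big_map /= !big_seq.
apply: eq_bigr => p; rewrite mem_primes => /and3P[p_pr _ pn].
by rewrite -expnM divnK // kn.
Qed.

(** All exponents are even, and 3 is the only prime whose exponent may be 2 modulo 4; in that case
    the factor 9 is split off. *)
Lemma Paley_order_necessary v : (1 < v)%N -> odd v -> Paley_order v ->
  ~ is_prime_power v ->
  exists n : nat, [/\ odd n, 1 < n & v = n ^ 4 \/ v = 9 * n ^ 4]%N.
Proof.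
move=> v1 ov [gT [G [D [abG Gv paleyD]]]] npp.
have v0 : (0 < v)%N := ltnW v1.
have logv p : prime p -> (p %| v)%N ->
    exists2 s, logn p v = s.*2 & forall m, (v = m ^ 2)%N -> odd s -> p = 3%N.
  rewrite -Gv => p_pr pv; rewrite -Gv in ov npp.
  exact: (Paley_PDS_logn abG ov paleyD npp p_pr pv).
have [m vm] : exists m, v = (m ^ 2)%N.
  apply: exact_root_of_logn => // p p_pr /(logv p p_pr)[s -> _].
  by rewrite -muln2 dvdn_mull.
have log4 p : prime p -> (p %| v)%N -> p != 3%N -> (4 %| logn p v)%N.
  move=> p_pr pv p3; have [s -> s3] := logv p p_pr pv.
  have /negbTE os : ~~ odd s by apply: contraNN p3 => os; apply/eqP/(s3 m).
  by rewrite -(odd_double_half s) os add0n -!muln2 -mulnA dvdn_mull.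
have ppow k : (0 < k)%N -> v <> (3 ^ k)%N.
  by move=> k0 v3; apply: npp; exists 3%N, k.
have [l3|l3] := boolP (4 %| logn 3 v)%N.
  have [n vn] : exists n, v = (n ^ 4)%N.
    apply: exact_root_of_logn => // p p_pr pv.
    by have [->|p3] := eqVneq p 3%N; last exact: log4.
  exists n; split; last by left.
    by move: ov; rewrite vn oddX.
  by rewrite ltnNge; apply/negP => n1; move: v1; rewrite vn; case: n n1 vn => [|[]].
have v3 : (3 %| v)%N.
  by apply: contraR l3 => v3; rewrite lognE (negPf v3) andbF.
have [s s2 _] := logv 3 isT v3.
have os : odd s.
  apply: contraR l3 => /negbTE os.
  by rewrite s2 -(odd_double_half s) os add0n -!muln2 -mulnA dvdn_mull.
have v9 : (9 %| v)%N.
  rewrite -[9%N]/(3 ^ 2)%N pfactor_dvdn // s2.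
  by rewrite -(odd_double_half s) os.
have w0 : (0 < v %/ 9)%N by rewrite divn_gt0 // dvdn_leq.
have [n vn] : exists n, (v %/ 9 = n ^ 4)%N.
  apply: exact_root_of_logn => // p p_pr pw.
  rewrite logn_div // -[9%N]/(3 ^ 2)%N lognX.
  have [->|p3] := eqVneq p 3%N; last first.
    rewrite (@logn_prime _ 3) // (negPf p3) muln0 subn0.
    by apply: log4 => //; apply: dvdn_trans pw (dvdn_div v9).
  rewrite (@logn_prime _ 3) // eqxx muln1 s2 -(odd_double_half s) os.
  by rewrite doubleD addKn -!muln2 -mulnA dvdn_mull.
have {}vn : v = (9 * n ^ 4)%N by rewrite -vn mulnC divnK.
exists n; split; last by right.
  by move: ov; rewrite vn oddM oddX.
rewrite ltnNge; apply/negP => n1; case: n n1 vn => [|[]] // _ vn.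
  by rewrite vn in v0.
(* [n = 1] would give [v = 9], a prime power. *)
by apply: (ppow 2).
Qed.

Local Close Scope ring_scope.

Theorem theorem1p2 (v : nat) (v_odd : odd v) (v_gt1 : 1 < v) :
  (exists (gT : finGroupType) (G : {group gT}) (D : {set gT}),
     [/\ abelian G, #|G| = v & is_Paley_PDS G D])
  <->
  (is_prime_power v /\ v = 1 %[mod 4])
  \/ (exists n : nat, [/\ odd n, 1 < n & v = n ^ 4 \/ v = 9 * n ^ 4]).
Proof.
split=> [vP|[[[p [m [p_pr m0 vE]]] v1]|[n [on n1 vE]]]].
- have v1 : v = 1 %[mod 4] by case: vP => gT [G [D [_ <- []]]].
  (* Being a prime power is decided by comparing [v] with the power of its least prime divisor that
     exactly divides it. *)
  have [vE|vN] := eqVneq v (pdiv v ^ logn (pdiv v) v).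
    left; split=> //; exists (pdiv v), (logn (pdiv v) v); split=> //.
      exact: pdiv_prime.
    by rewrite logn_gt0 pi_pdiv.
  have npp : ~ is_prime_power v.
    case=> p [[|m] [p_pr // _ vE]]; case/eqP: vN.
    by rewrite vE pdiv_pfactor // pfactorK.
  by right; apply: Paley_order_necessary.
- by rewrite vE in v1 *; apply: Paley_order_prime_power.
have n4 := has_turyn_family_pow4 on n1.
case: vE => vE; apply: turyn_family_Paley.
- by rewrite vE (expnM n 2 2) odd_sqr_mod4 ?oddX ?on.
- by rewrite vE.
- have -> : v = (3 * n ^ 2) ^ 2 by rewrite vE expnMn -expnM.
  by rewrite odd_sqr_mod4 ?oddM ?oddX ?on.
by rewrite vE; apply: turyn_family_prod; first exact: has_turyn_family9.
Qed.
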